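(* Let $(R,\mathfrak{m})$ be a Noetherian local ring, let $J$ be an arbitrary ideal of $R$, let $M$ be a finitely generated $R$-module, and let $x_1,\ldots,x_r \in R$ be a $J$-filter regular sequence on $M$. For each $i=1,\ldots,r$ define $$a_i = a_J\left(\frac{(x_1,\ldots,x_{i-1})M : x_i}{(x_1,\ldots,x_{i-1})M}\right),$$ and let $$N = \max\left\{a_1 + 2a_2 + \cdots + 2^{r-1}a_r,\ \operatorname{ar}_J(x_1M),\ \ldots,\ \operatorname{ar}_J((x_1,\ldots,x_r)M)\right\} + 2.$$ For every $\varepsilon_1,\ldots,\varepsilon_r \in J^N$, let $x_i' = x_i + \varepsilon_i$ for $i=1,\ldots,r$. Then for all $j \geq 0$: (i) $\beta_j^R\left(M/(x_1,\ldots,x_r)M\right) = \beta_j^R\left(M/(x_1',\ldots,x_r')M\right)$; (ii) $\mu^j_R\left(M/(x_1,\ldots,x_r)M\right) = \mu^j_R\left(M/(x_1',\ldots,x_r')M\right)$.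
   Context: Let $k=R/\mathfrak{m}$ be the residue field of $R$. Colon: for a submodule $K\subseteq M$ and $x\in R$, $K : x = \{m \in M \mid xm \in K\}$; for $i=1$, $(x_1,\ldots,x_{i-1})M = 0$, so $a_1 = a_J(0:_M x_1)$ where $0:_M x=\{m\in M\mid xm=0\}$. $J$-Loewy length: $a_J(L) = \inf\{n \in \mathbb{N} \mid J^nL=0\}$ for an $R$-module $L$ (with $J^0=R$). $J$-filter regular sequence: $x_1,\ldots,x_r\in R$ is $J$-filter regular on $M$ if for each $i=1,\ldots,r$ the element $x_i$ is not contained in any associated prime of $M/(x_1,\ldots,x_{i-1})M$ that does not lie in $V(J)$ (the set of primes containing $J$). Equivalently, $a_J\left(\frac{(x_1,\ldots,x_{i-1})M:x_i}{(x_1,\ldots,x_{i-1})M}\right)<\infty$ for all $1\le i\le r$. Artin–Rees number: for a submodule $K \subseteq M$, $\operatorname{ar}_J(K)$ is the least integer $c\ge 0$ such that $J^nM\cap K = J^{n-c}(J^cM\cap K)$ for all $n\ge c$. Betti and Bass numbers: for a finitely generated $R$-module $L$, $\beta_j^R(L)=\dim_k\operatorname{Tor}_j^R(k,L)$ and $\mu^j_R(L)=\dim_k\operatorname{Ext}^j_R(k,L)$.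
   Formalization: The ideal J is assumed proper (J ≠ R) instead of arbitrary; for J = R the claim fails, e.g. R = M = k[[t]], r = 1, x_1 = t, ε_1 = −t, where N = 2, x_1' = 0 and β_1(R/t) = 1 but β_1(R) = 0. *)

(* Defs.v *)
From HB Require Import structures.
From mathcomp Require Import all_boot all_order all_algebra.
From mathcomp Require Import boolp classical_sets.

Set Implicit Arguments.
Unset Strict Implicit.
Unset Printing Implicit Defensive.

Import GRing.Theory.
Local Open Scope ring_scope.
Local Open Scope quotient_scope.

(* Submodules of an R-module V are the library's [submodClosed V], made        *)
(* decidable with [asbool]. Ideals of R are the submodules of R^o, so that R   *)
(* itself is also an ideal (which excludes the library's [idealr]).            *)
Notation ideal R := (submodClosed (R : comNzRingType)^o).

Section Submodules.
Variable R : comNzRingType.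

Definition full_mod (V : lmodType R) : {pred V} := fun=> true.
Arguments full_mod : clear implicits.

Fact full_mod_closed (V : lmodType R) : submod_closed (full_mod V).
Proof. by []. Qed.
HB.instance Definition _ (V : lmodType R) :=
  GRing.isSubmodClosed.Build R V (full_mod V) (@full_mod_closed V).

Definition span_of (V : lmodType R) (S : V -> Prop) : {pred V} :=
  fun v => `[< forall K : submodClosed V, (forall s, S s -> s \in K) -> v \in K >].

Fact span_of_closed (V : lmodType R) (S : V -> Prop) : submod_closed (span_of S).
Proof.
split=> [|a u v /asboolP hu /asboolP hv]; apply/asboolP => K SK.
  exact: rpred0.
by rewrite rpredD ?rpredZ ?hu ?hv.
Qed.
HB.instance Definition _ (V : lmodType R) (S : V -> Prop) :=
  GRing.isSubmodClosed.Build R V (span_of S) (span_of_closed S).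

Definition cap_mod (V : lmodType R) (A B : submodClosed V) : {pred V} :=
  fun v => (v \in A) && (v \in B).

Fact cap_mod_closed (V : lmodType R) (A B : submodClosed V) :
  submod_closed (cap_mod A B).
Proof.
split=> [|a u v /andP[uA uB] /andP[vA vB]]; first by apply/andP; rewrite !rpred0.
by apply/andP; split; rewrite rpredD ?rpredZ.
Qed.
HB.instance Definition _ (V : lmodType R) (A B : submodClosed V) :=
  GRing.isSubmodClosed.Build R V (cap_mod A B) (cap_mod_closed A B).

Definition preim_mod (U V : lmodType R) (f : {linear U -> V}) (K : submodClosed V) :
  {pred U} := fun u => f u \in K.

Fact preim_mod_closed (U V : lmodType R) (f : {linear U -> V}) (K : submodClosed V) :
  submod_closed (preim_mod f K).
Proof.
split=> [|a u v fu fv]; rewrite /preim_mod unfold_in ?linear0 ?rpred0 //.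
by rewrite linearP rpredD ?rpredZ.
Qed.
HB.instance Definition _ (U V : lmodType R) (f : {linear U -> V})
    (K : submodClosed V) :=
  GRing.isSubmodClosed.Build R U (preim_mod f K) (preim_mod_closed f K).

Definition ker_mod (U V : lmodType R) (f : {linear U -> V}) : {pred U} :=
  fun u => f u == 0.

Fact ker_mod_closed (U V : lmodType R) (f : {linear U -> V}) : submod_closed (ker_mod f).
Proof.
split=> [|a u v /eqP fu /eqP fv]; rewrite /ker_mod unfold_in ?linear0 //.
by rewrite linearP fu fv scaler0 addr0.
Qed.
HB.instance Definition _ (U V : lmodType R) (f : {linear U -> V}) :=
  GRing.isSubmodClosed.Build R U (ker_mod f) (ker_mod_closed f).

Definition im_mod (U V : lmodType R) (f : {linear U -> V}) : {pred V} :=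
  fun v => `[< exists u, v = f u >].

Fact im_mod_closed (U V : lmodType R) (f : {linear U -> V}) : submod_closed (im_mod f).
Proof.
split=> [|a _ _ /asboolP[u ->] /asboolP[v ->]]; apply/asboolP.
  by exists 0; rewrite linear0.
by exists (a *: u + v); rewrite linearP.
Qed.
HB.instance Definition _ (U V : lmodType R) (f : {linear U -> V}) :=
  GRing.isSubmodClosed.Build R V (im_mod f) (im_mod_closed f).

(* K : x *)
Definition colon (V : lmodType R) (K : submodClosed V) (x : R) : {pred V} :=
  fun v => x *: v \in K.

Fact colon_closed (V : lmodType R) (K : submodClosed V) (x : R) :
  submod_closed (colon K x).
Proof.
split=> [|a u v xu xv]; rewrite /colon unfold_in.
  by rewrite scaler0 rpred0.
by rewrite scalerDr scalerA mulrC -scalerA; apply: rpredD => //; apply: rpredZ.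
Qed.
HB.instance Definition _ (V : lmodType R) (K : submodClosed V) (x : R) :=
  GRing.isSubmodClosed.Build R V (colon K x) (colon_closed K x).

(* The product I K, i.e. the submodule generated by the a v, a in I, v in K. *)
Definition mul_mod (V : lmodType R) (I : ideal R) (K : submodClosed V) :
    submodClosed V :=
  span_of (fun w => exists a v, [/\ a \in I, v \in K & w = a *: v]).

Fixpoint ideal_exp (J : ideal R) (n : nat) : ideal R :=
  if n is n'.+1 then mul_mod J (ideal_exp J n') else full_mod R^o.

End Submodules.
Arguments full_mod {R} V.

Section SubquotientModules.
Variable R : comNzRingType.

Definition submod_type (V : lmodType R) (K : submodClosed V) : Type :=
  {v : V | v \in K}.
HB.instance Definition _ (V : lmodType R) (K : submodClosed V) :=
  SubChoice.on (submod_type K).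
HB.instance Definition _ (V : lmodType R) (K : submodClosed V) :=
  [SubChoice_isSubLmodule of submod_type K by <:].

(* [submodClosed] does not record closure under opposite. *)
Definition zmod_of (V : lmodType R) (K : submodClosed V) : {pred V} :=
  fun v => v \in K.

Fact zmod_of_closed (V : lmodType R) (K : submodClosed V) : zmod_closed (zmod_of K).
Proof.
split=> [|u v uK vK]; first exact: rpred0.
by rewrite /zmod_of unfold_in -scaleN1r rpredD ?rpredZ.
Qed.
HB.instance Definition _ (V : lmodType R) (K : submodClosed V) :=
  GRing.isZmodClosed.Build V (zmod_of K) (zmod_of_closed K).

Definition quot_mod (V : lmodType R) (K : submodClosed V) : Type :=
  Quotient.quot (zmod_of K).

Section QuotientScaling.
Variables (V : lmodType R) (K : submodClosed V).
HB.instance Definition _ := GRing.Zmodule.on (quot_mod K).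
HB.instance Definition _ :=
  ZmodQuotient.copy (quot_mod K) (Quotient.quot (zmod_of K)).

Definition quot_scale (a : R) (u : quot_mod K) : quot_mod K :=
  \pi_(quot_mod K) (a *: repr u).

Fact quot_scale_pi (a : R) (v : V) :
  quot_scale a (\pi_(quot_mod K) v) = \pi_(quot_mod K) (a *: v).
Proof.
have: repr (\pi_(quot_mod K) v) - v \in zmod_of K by rewrite Quotient.idealrBE reprK.
move=> /(rpredZ (s := K) a); rewrite scalerBr => h.
by apply/eqP; rewrite -Quotient.idealrBE.
Qed.

Fact quot_scaleA a b u : quot_scale a (quot_scale b u) = quot_scale (a * b) u.
Proof. by rewrite [quot_scale b u]/quot_scale quot_scale_pi scalerA. Qed.
Fact quot_scale1 : left_id 1 quot_scale.
Proof. by move=> u; rewrite /quot_scale scale1r reprK. Qed.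
Fact quot_scaleDr : right_distributive quot_scale +%R.
Proof.
move=> a u v; elim/quotW: u => u; elim/quotW: v => v.
by rewrite -raddfD !quot_scale_pi scalerDr raddfD.
Qed.
Fact quot_scaleDl v : {morph quot_scale^~ v : a b / a + b}.
Proof. by move=> a b; rewrite /quot_scale scalerDl raddfD. Qed.
HB.instance Definition _ := GRing.Zmodule_isLmodule.Build R (quot_mod K)
  quot_scaleA quot_scale1 quot_scaleDr quot_scaleDl.
End QuotientScaling.

(* The subquotient A / (A n B); it is A / B when B is contained in A. *)
Definition subquot (V : lmodType R) (A B : submodClosed V) : lmodType R :=
  quot_mod (preim_mod (val : {linear submod_type A -> V}) B).

End SubquotientModules.

Section CommutativeAlgebra.
Variable R : comNzRingType.

Definition maximal_ideal (m : ideal R) : Prop :=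
  1 \notin m /\
  forall I : ideal R, {subset m <= I} -> 1 \notin I -> I =i m.

Definition local_ring (m : ideal R) : Prop :=
  maximal_ideal m /\ forall m' : ideal R, maximal_ideal m' -> m' =i m.

Definition ideal_gen (n : nat) (s : 'I_n -> R) : ideal R :=
  span_of (fun a : R^o => exists i, a = s i).

Definition noetherian_ring : Prop :=
  forall I : ideal R, exists n (s : 'I_n -> R), I =i ideal_gen s.

Definition fg_module (M : lmodType R) : Prop :=
  exists n (s : 'I_n -> M), forall v, v \in span_of (fun w => exists i, w = s i).

Definition prime_ideal (p : ideal R) : Prop :=
  1 \notin p /\ forall a b : R, a * b \in p -> a \in p \/ b \in p.

Definition associated_prime (M : lmodType R) (p : ideal R) : Prop :=
  prime_ideal p /\ exists v : M, forall a : R, (a \in p) <-> (a *: v = 0).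

(* (x_1, ..., x_i) M; the entries of x are numbered from 0. *)
Definition partial_mul (r : nat) (x : 'I_r -> R) (M : lmodType R) (i : nat) :
    submodClosed M :=
  mul_mod (span_of (fun a : R^o => exists2 k : 'I_r, (k < i)%N & a = x k) : ideal R)
    (full_mod M).

Definition filter_regular (J : ideal R) (M : lmodType R) (r : nat)
    (x : 'I_r -> R) : Prop :=
  forall (i : 'I_r) (p : ideal R),
    associated_prime (quot_mod (partial_mul x M i)) p ->
    ~ {subset J <= p} -> x i \notin p.

(* Least element of P, with value 0 if P is empty. *)
Definition least (P : nat -> Prop) : nat :=
  xget 0%N [set n | P n /\ forall k, P k -> (n <= k)%N]%classic.

(* The value is meaningful only if some power of J kills L; for the modules    *)
(* attached to a J-filter regular sequence on a finitely generated module over *)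
(* a noetherian ring, this is the case.                                        *)
Definition loewy_length (J : ideal R) (L : lmodType R) : nat :=
  least (fun n => forall v, v \in mul_mod (ideal_exp J n) (full_mod L) -> v = 0).

Definition artin_rees (J : ideal R) (M : lmodType R) (K : submodClosed M) : nat :=
  least (fun c => forall n, (c <= n)%N ->
    cap_mod (mul_mod (ideal_exp J n) (full_mod M)) K =i
    mul_mod (ideal_exp J (n - c)) (cap_mod (mul_mod (ideal_exp J c) (full_mod M)) K)).

(* a_i, with i numbered from 0 *)
Definition colon_length (J : ideal R) (M : lmodType R) (r : nat) (x : 'I_r -> R)
    (i : 'I_r) : nat :=
  loewy_length J (subquot (colon (partial_mul x M i) (x i)) (partial_mul x M i)).

End CommutativeAlgebra.

Section Homology.
Variable R : comNzRingType.

(* A resolution ... -> R^(rank 1) -> R^(rank 0) -> N -> 0 by finite free      *)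
(* modules; matrices act on row vectors from the right.                        *)
Record free_resolution (N : lmodType R) := FreeResolution {
  rank : nat -> nat;
  diff : forall j, 'M[R]_(rank j.+1, rank j);
  augm : {linear 'rV[R]_(rank 0) -> N};
  augm_surj : forall y, exists u, augm u = y;
  augm_exact : forall u, augm u = 0 <-> exists w : 'rV[R]_(rank 1), u = w *m diff 0;
  diff_exact : forall j (u : 'rV[R]_(rank j.+1)),
    u *m diff j = 0 <-> exists w : 'rV[R]_(rank j.+2), u = w *m diff j.+1
}.

(* Under the identification of R^n (x) L with L^n, [mx_tensor L A] is the map  *)
(* A (x) 1 : R^p (x) L -> R^n (x) L. Under the identification of Hom(R^n, L)   *)
(* with L^n (evaluation at the canonical basis), composition with A is         *)
(* [mx_tensor L A^T] : Hom(R^n, L) -> Hom(R^p, L).                             *)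
Definition mx_tensor (L : lmodType R) (p n : nat) (A : 'M[R]_(p, n))
    (v : {ffun 'I_p -> L}) : {ffun 'I_n -> L} :=
  [ffun k => \sum_i A i k *: v i].

Fact mx_tensor_linear (L : lmodType R) (p n : nat) (A : 'M[R]_(p, n)) :
  linear (@mx_tensor L p n A).
Proof.
move=> a u v; apply/ffunP => k; rewrite !ffunE scaler_sumr -big_split /=.
by apply: eq_bigr => i _; rewrite !ffunE scalerDr !scalerA mulrC.
Qed.
HB.instance Definition _ (L : lmodType R) (p n : nat) (A : 'M[R]_(p, n)) :=
  GRing.isLinear.Build R {ffun 'I_p -> L} {ffun 'I_n -> L} _ (@mx_tensor L p n A)
    (@mx_tensor_linear L p n A).

Variables (N : lmodType R) (F : free_resolution N) (L : lmodType R).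

(* Tor_j(N, L) = H_j(F (x) L) *)
Definition Tor (j : nat) : lmodType R :=
  match j with
  | 0 => subquot (full_mod {ffun 'I_(rank F 0) -> L}) (im_mod (@mx_tensor L _ _ (diff F 0)))
  | j'.+1 => subquot (ker_mod (@mx_tensor L _ _ (diff F j')))
                     (im_mod (@mx_tensor L _ _ (diff F j'.+1)))
  end.

(* Ext^j(N, L) = H^j(Hom(F, L)) *)
Definition Ext (j : nat) : lmodType R :=
  match j with
  | 0 => subquot (ker_mod (@mx_tensor L _ _ (diff F 0)^T))
                 (im_mod (\0 : {linear L -> {ffun 'I_(rank F 0) -> L}}))
  | j'.+1 => subquot (ker_mod (@mx_tensor L _ _ (diff F j'.+1)^T))
                     (im_mod (@mx_tensor L _ _ (diff F j')^T))
  end.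

End Homology.

Section BettiBass.
Variables (R : comNzRingType) (m : ideal R).

(* V is a vector space of dimension d over k = R / m, i.e. m V = 0 and V has a *)
(* k-basis e_1, ..., e_d. Scalars in k are given by representatives in R.      *)
Definition has_residue_dim (V : lmodType R) (d : nat) : Prop :=
  (forall (a : R) (v : V), a \in m -> a *: v = 0) /\
  exists e : 'I_d -> V,
    (forall v, exists c : 'I_d -> R, v = \sum_i c i *: e i) /\
    (forall c : 'I_d -> R, \sum_i c i *: e i = 0 -> forall i, c i \in m).

(* dim_k Tor_j(k, L) and dim_k Ext^j(k, L), computed from a resolution of the  *)
(* residue field k = R / m by finite free modules. When R is noetherian and L  *)
(* is finitely generated, a resolution F exists and the dimension is finite    *)
(* and does not depend on F, so that the default value 0 is not used.          *)
Definition betti (L : lmodType R) (j : nat) : nat :=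
  xget 0%N [set d | exists F : free_resolution (quot_mod m),
                    has_residue_dim (Tor F L j) d]%classic.

Definition bass (L : lmodType R) (j : nat) : nat :=
  xget 0%N [set d | exists F : free_resolution (quot_mod m),
                    has_residue_dim (Ext F L j) d]%classic.

End BettiBass.

(* Main.v *)
From HB Require Import structures.
Require Import Defs.
From mathcomp Require Import all_boot all_order all_algebra zify.
From mathcomp Require Import boolp classical_sets functions.

Set Implicit Arguments.
Unset Strict Implicit.
Unset Printing Implicit Defensive.

Import GRing.Theory.
Local Open Scope ring_scope.

(** The elements are changed one at a time. Let x be the element to be replaced by
    x' = x + eps, and let K be the submodule generated by the multiples of all the
    others, so that M / (K + x M) is to be compared with M / (K + x' M). If
    K : x = K : x', these modules are the cokernels of the injective maps
    M / (K : x) -> M / K given by x and by x', and are quasi-isomorphic to their cones. The difference eps of these maps is a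
    sum of products b a with b in m and a in J^(N-1); as J^(N-1) (K : x) is in K, each
    a is itself a map from M / (K : x) to M / K. Multiplication by b is homotopic to
    zero on a free resolution F of the residue field, so eps is homotopic to zero
    after tensoring with F, and also after applying Hom(F, -). Hence the two cones
    become isomorphic, and so do Tor_j and Ext^j, for all j at once
    ([homotopy_ideal], [homology_dim], [betti_bass_eq]). The isomorphism appears as
    the relation [cone_rel] between cycles.

    Two facts are needed at each step. First, J^(N-1) (K : x) is in K: the
    exponents for a sequence add up when one of its elements is moved to the end
    ([kills_colon_swap]), so a_1 + ... + a_r is enough. Second, K : x = K : x':
    this follows from Krull's intersection theorem by successive approximation,
    since N exceeds an Artin-Rees number of K + x M ([colon_perturbed]).

    Neither bound deteriorates when one element is replaced. The Artin-Rees number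
    is controlled by the initial forms of K + x M, which do not see eps
    ([AR_perturbed]), and the exponents a_i of the later elements stay valid by an
    explicit correction of order N together with Nakayama's lemma
    ([kills_colon_perturbed]).

    The numbers a_i and the Artin-Rees numbers exist: the former because a prime
    associated with M / I avoids x unless it contains J ([loewy_finite]), the latter
    by the Artin-Rees lemma ([artin_rees_exists]), deduced from a form of Hilbert's
    basis theorem for modules with commuting operators ([hilbert_basis]). *)

(** * Submodules and products with ideals *)

Section PropSubmodules.
Variables (R : comNzRingType) (V : lmodType R).
Implicit Types (K T : submodClosed V) (a : R) (u v : V).

Lemma memN K v : v \in K -> - v \in K.
Proof. by move=> vK; rewrite -scaleN1r rpredZ. Qed.

Lemma memB K u v : u \in K -> v \in K -> u - v \in K.
Proof. by move=> uK vK; rewrite rpredD ?memN. Qed.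

Lemma memBC K u v : u - v \in K -> v - u \in K.
Proof. by move=> /memN; rewrite opprB. Qed.

Lemma mem_congr K u v : u - v \in K -> v \in K -> u \in K.
Proof. by move=> uvK vK; rewrite -(subrK v u) rpredD. Qed.

Lemma congr_trans K v u w : u - v \in K -> v - w \in K -> u - w \in K.
Proof. by move=> uv vw; have := rpredD uv vw; rewrite addrA subrK. Qed.

Definition prop_submod_closed (P : V -> Prop) : Prop :=
  P 0 /\ forall a u v, P u -> P v -> P (a *: u + v).

(** Submodules are boolean predicates; classical truth values turn a proposition
    closed under linear combinations into one. *)
Definition prop_submod (P : V -> Prop) (hP : prop_submod_closed P) : {pred V} :=
  fun v => `[< P v >].

Fact prop_submod_subproof P (hP : prop_submod_closed P) :
  submod_closed (prop_submod hP).
Proof.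
split=> [|a u v /asboolP Pu /asboolP Pv]; apply/asboolP; first exact: hP.1.
exact: hP.2.
Qed.
HB.instance Definition _ P (hP : prop_submod_closed P) :=
  GRing.isSubmodClosed.Build R V (prop_submod hP) (prop_submod_subproof hP).

Lemma prop_submodP P (hP : prop_submod_closed P) v :
  reflect (P v) (v \in prop_submod hP).
Proof. exact: asboolP. Qed.

Lemma mem_span (S : V -> Prop) v : S v -> v \in span_of S.
Proof. by move=> Sv; apply/asboolP => K; apply. Qed.

Lemma span_sub (S : V -> Prop) K :
  (forall s, S s -> s \in K) -> {subset span_of S <= K}.
Proof. by move=> SK v /asboolP; apply. Qed.

Lemma span_ind (S P : V -> Prop) : prop_submod_closed P ->
  (forall s, S s -> P s) -> forall v, v \in span_of S -> P v.
Proof.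
move=> hP SP v vS; apply/(prop_submodP hP); move: v vS.
by apply: span_sub => s /SP Ps; apply/prop_submodP.
Qed.

Lemma scaleR (a b : R) : a *: (b : R^o) = a * b.
Proof. by []. Qed.

Lemma mem_mul (I : ideal R) K (a : R) v : a \in I -> v \in K -> a *: v \in mul_mod I K.
Proof. by move=> aI vK; apply: mem_span; exists a, v. Qed.

Lemma mul_ind (I : ideal R) K (P : V -> Prop) : prop_submod_closed P ->
  (forall (a : R) v, a \in I -> v \in K -> P (a *: v)) ->
  forall v, v \in mul_mod I K -> P v.
Proof. by move=> hP IKP; apply: span_ind => // _ [a [v [? ? ->]]]; exact: IKP. Qed.

Lemma mul_sub (I : ideal R) K T :
  (forall (a : R) v, a \in I -> v \in K -> a *: v \in T) ->
  {subset mul_mod I K <= T}.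
Proof. by move=> IKT; apply: span_sub => _ [a [v [? ? ->]]]; exact: IKT. Qed.

Lemma mul_subr (I : ideal R) K : {subset mul_mod I K <= K}.
Proof. by apply: mul_sub => a v _; exact: rpredZ. Qed.

Lemma mulS (I I' : ideal R) K K' : {subset I <= I'} -> {subset K <= K'} ->
  {subset mul_mod I K <= mul_mod I' K'}.
Proof. by move=> II KK; apply: mul_sub => a v /II ? /KK ?; exact: mem_mul. Qed.

End PropSubmodules.

(* Products of submodules must stay folded for their submodule structure to be
   found by unification. *)
#[local] Opaque mul_mod.

Section ProductAssociativity.
Variables (R : comNzRingType) (V : lmodType R).
Implicit Types (K T : submodClosed V).

Lemma mem_mulR (I I' : ideal R) (a b : R) :
  a \in I -> b \in I' -> a * b \in mul_mod I I'.
Proof. by move=> aI bI; exact: (mem_mul (V := R^o)). Qed.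

Lemma mulA_sub (I I' : ideal R) K :
  {subset mul_mod (mul_mod I I') K <= mul_mod I (mul_mod I' K)}.
Proof.
apply: mul_sub => a v aI vK; move: a aI.
apply: (mul_ind (V := R^o) (P := fun a : R^o => a *: v \in mul_mod I (mul_mod I' K))).
  split=> [|a b c hb hc]; first by rewrite scale0r rpred0.
  by rewrite scalerDl scaleR -scalerA rpredD // rpredZ.
by move=> a b aI bI' /=; rewrite scaleR -scalerA !mem_mul.
Qed.

Lemma mulA_sup (I I' : ideal R) K :
  {subset mul_mod I (mul_mod I' K) <= mul_mod (mul_mod I I') K}.
Proof.
apply: mul_sub => a v aI; move: v.
apply: (mul_ind (P := fun v : V => a *: v \in mul_mod (mul_mod I I') K)).
  split=> [|c u v hu hv]; first by rewrite scaler0 rpred0.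
  by rewrite scalerDr scalerA mulrC -scalerA rpredD // rpredZ.
by move=> b v bI vK; rewrite scalerA -scaleR; apply: mem_mul => //; exact: mem_mul.
Qed.

End ProductAssociativity.

(** * Powers of an ideal *)

Section IdealPowers.
Variables (R : comNzRingType) (J : ideal R).

Lemma expD_mem m n (a b : R) :
  a \in ideal_exp J m -> b \in ideal_exp J n -> a * b \in ideal_exp J (m + n).
Proof.
move=> aJ bJ; elim: m a aJ => [|m IHm]; first by move=> a _; exact: rpredZ.
apply: (mul_ind (V := R^o) (P := fun a : R^o => a * b \in ideal_exp J (m.+1 + n))).
  split=> [|c u v hu hv] /=; first by rewrite mul0r rpred0.
  by rewrite scaleR mulrDl -mulrA rpredD // (rpredZ (s := mul_mod _ _) c).
by move=> c v cJ vJ; rewrite scaleR -mulrA; apply: mem_mulR => //; exact: IHm.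
Qed.

Lemma expD_split m n (a : R) :
  a \in ideal_exp J (m + n) -> a \in mul_mod (ideal_exp J m) (ideal_exp J n).
Proof.
elim: m a => [|m IHm] a aJ; first by rewrite -(mul1r a); apply: mem_mulR.
apply: mulA_sup; exact: (mulS (V := R^o) (fun _ h => h) IHm aJ).
Qed.

Lemma exp_decr m n : (m <= n)%N -> {subset ideal_exp J n <= ideal_exp J m}.
Proof. by move=> /subnK <- a /expD_split; apply: mul_subr. Qed.

Lemma exp1_sub : {subset ideal_exp J 1 <= J}.
Proof.
by apply: mul_sub => a b aJ _; rewrite scaleR mulrC -scaleR rpredZ.
Qed.

Lemma mem_exp1 (a : R) : a \in J -> a \in ideal_exp J 1.
Proof. by move=> aJ; rewrite -(mulr1 a); apply: mem_mulR. Qed.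

Variable M : lmodType R.
Implicit Types K T : submodClosed M.

Lemma mul_exp0 K v : (v \in mul_mod (ideal_exp J 0) K) = (v \in K).
Proof.
apply/idP/idP; first exact: mul_subr.
by move=> vK; rewrite -(scale1r v) mem_mul.
Qed.

Lemma mul_expD m n K v :
  (v \in mul_mod (ideal_exp J (m + n)) K) =
  (v \in mul_mod (ideal_exp J m) (mul_mod (ideal_exp J n) K)).
Proof.
apply/idP/idP=> [|/mulA_sup]; last by apply: mulS => // a; apply: mul_sub => ? ?; exact: expD_mem.
by move=> /(mulS (@expD_split m n) (fun _ h => h)); exact: mulA_sub.
Qed.

Lemma mul_expS n K v :
  (v \in mul_mod (ideal_exp J n.+1) K) = (v \in mul_mod J (mul_mod (ideal_exp J n) K)).
Proof. by apply/idP/idP=> [/mulA_sub|/mulA_sup]. Qed.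

Lemma mul_exp_decr m n K : (m <= n)%N ->
  {subset mul_mod (ideal_exp J n) K <= mul_mod (ideal_exp J m) K}.
Proof. by move=> /exp_decr h; exact: mulS. Qed.

Definition powM (n : nat) : submodClosed M := mul_mod (ideal_exp J n) (full_mod M).

Lemma powM0 v : v \in powM 0.
Proof. by rewrite /powM mul_exp0. Qed.

Lemma powM_decr m n : (m <= n)%N -> {subset powM n <= powM m}.
Proof. exact: mul_exp_decr. Qed.

Lemma powM_scale m n (a : R) v : a \in ideal_exp J m -> v \in powM n ->
  a *: v \in powM (m + n).
Proof. by move=> aJ vJ; rewrite /powM mul_expD mem_mul. Qed.

End IdealPowers.
Arguments powM {R} J M n.

(** * Noetherian modules *)

Section Noetherian.
Variables (R : comNzRingType) (V : lmodType R).
Implicit Types (K T : submodClosed V) (a : R) (u v : V) (l : seq V).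

Definition span_seq l : submodClosed V := span_of (fun w => w \in l).

Definition fg_submod K : Prop := exists l, K =i span_seq l.

Lemma fg_submodP K l : {subset l <= K} -> {subset K <= span_seq l} -> fg_submod K.
Proof. by move=> lK Kl; exists l => v; apply/idP/idP => [/Kl|]; last exact: span_sub. Qed.

Lemma mem_span_seq l v : v \in l -> v \in span_seq l.
Proof. exact: mem_span. Qed.

Lemma span_seqS l l' : {subset l <= l'} -> {subset span_seq l <= span_seq l'}.
Proof. by move=> ll; apply: span_sub => s /ll; exact: mem_span_seq. Qed.

Lemma span_consP v l u : u \in span_seq (v :: l) -> exists a, u - a *: v \in span_seq l.
Proof.
apply: (span_ind (P := fun u => exists a, u - a *: v \in span_seq l)).
  split=> [|a w z [b hb] [c hc]]; first by exists 0; rewrite scale0r subr0 rpred0.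
  exists (a * b + c); rewrite scalerDl -scalerA opprD addrACA -scalerBr.
  by rewrite rpredD // rpredZ.
move=> s; rewrite inE => /predU1P[->|sl]; first by exists 1; rewrite scale1r subrr rpred0.
by exists 0; rewrite scale0r subr0 mem_span_seq.
Qed.

Definition noetherian_module : Prop := forall K, fg_submod K.

(** If no element of the family were maximal, dependent choice would give a
    strictly increasing chain; the finitely many generators of its union lie in
    one member of the chain. *)
Lemma noetherian_maximal (P : submodClosed V -> Prop) : noetherian_module ->
  (exists K, P K) ->
  exists2 K, P K & forall K', P K' -> {subset K <= K'} -> {subset K' <= K}.
Proof.
move=> noethV [K0 PK0]; apply: contrapT => noMax.
have step K : exists K', P K -> [/\ P K', {subset K <= K'} & exists2 v, v \in K' & v \notin K].
  have [PK|nPK] := EM (P K); last by exists K.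
  apply: contrapT => noK'; apply: noMax; exists K => // K' PK' KK' v vK'.
  apply: contrapT => /negP vK; apply: noK'; exists K' => _; split=> //; by exists v.
have [f fP] := choice step.
pose c n := iter n f K0.
have cP n : P (c n) by elim: n => //= n IHn; case: (fP _ IHn).
have cS n : {subset c n <= c n.+1} by case: (fP _ (cP n)).
have cD m n : (m <= n)%N -> {subset c m <= c n}.
  move=> /subnK <-; elim: (n - m)%N => // k IHk v /IHk; rewrite addSn; exact: cS.
have hU : prop_submod_closed (fun v => exists n, v \in c n).
  split=> [|a u v [p up] [q vq]]; first by exists 0%N; rewrite rpred0.
  exists (maxn p q); rewrite rpredD ?rpredZ //.
    exact: cD (leq_maxl _ _) _ up.
  exact: cD (leq_maxr _ _) _ vq.
have [l lU] := noethV (prop_submod hU).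
have [n ln] : exists n, {subset l <= c n}.
  have : {subset l <= prop_submod hU} by move=> v vl; rewrite lU mem_span_seq.
  elim: (l) => [|v l' IHl] hl; first by exists 0%N.
  have [w wl|p hp] := IHl; first by apply: hl; rewrite inE wl orbT.
  have /prop_submodP[q hq] := hl v (mem_head _ _).
  exists (maxn p q) => w; rewrite inE => /predU1P[->|/hp].
    exact: cD (leq_maxr _ _) _ hq.
  exact: cD (leq_maxl _ _) _.
have [_ _ [v vS /negP]] := fP _ (cP n); apply.
have: v \in prop_submod hU by apply/prop_submodP; exists n.+1.
by rewrite lU; apply: span_sub.
Qed.

End Noetherian.

Section NoetherianRing.
Variables (R : comNzRingType) (R_noeth : noetherian_ring R).

Lemma noetherian_ring_module : noetherian_module R^o.
Proof.
move=> I; have [n [s sI]] := R_noeth I; exists (codom s) => a; rewrite sI.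
apply/idP/idP; apply: span_sub => b; first by move=> [i ->]; rewrite mem_span_seq ?codom_f.
by move=> /codomP[i ->]; apply: mem_span; exists i.
Qed.

(** Induction on the number of generators: the coefficients of the first
    generator in elements of K form an ideal. *)
Lemma fg_module_noetherian (M : lmodType R) : fg_module M -> noetherian_module M.
Proof.
case=> n [s sM] K.
have : {subset K <= span_seq (codom s)}.
  move=> v _; move: v (sM v); apply: span_sub => _ [i ->]; exact/mem_span_seq/codom_f.
elim: (codom s) K => [|t l IHl] K Kl.
  by exists [::] => v; apply/idP/idP => [/Kl//|]; apply: span_sub.
have hI : prop_submod_closed (V := R^o)
    (fun a : R^o => exists2 k, k \in K & k - (a : R) *: t \in span_seq l).
  split=> [|a b c [u uK hu] [v vK hv]]; first by exists 0; rewrite ?scale0r ?subrr rpred0.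
  exists (a *: u + v); first by rewrite rpredD // rpredZ.
  by rewrite scalerDl scaleR -scalerA opprD addrACA -scalerBr rpredD // rpredZ.
have [la laI] := noetherian_ring_module (prop_submod hI).
have [|l0 l0K] := IHl (cap_mod K (span_seq l)); first by move=> v /andP[].
have pick a : exists k, a \in (prop_submod hI) -> k \in K /\ k - (a : R) *: t \in span_seq l.
  by case: (boolP (a \in _)) => [/prop_submodP[k kK hk]|_]; [exists k | exists 0].
have [f fP] := choice pick.
have faP a : a \in la -> f a \in K /\ f a - (a : R) *: t \in span_seq l.
  by move=> ala; apply: fP; rewrite laI mem_span_seq.
apply: (fg_submodP (l := map f la ++ l0)) => v.
  rewrite mem_cat => /orP[/mapP[a /faP[faK _] ->]//|vl0].
  have: v \in cap_mod K (span_seq l) by rewrite l0K mem_span_seq.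
  by case/andP.
move=> vK; have [a ha] := span_consP (Kl v vK).
have: a \in prop_submod hI by apply/(prop_submodP hI); exists v.
rewrite laI => ala.
have [w ws wa] : exists2 w, w \in span_seq (map f la) & w - a *: t \in span_seq l.
  move: a ala {ha}.
  apply: (span_ind (V := R^o) (P := fun a : R^o =>
    exists2 w, w \in span_seq (map f la) & w - (a : R) *: t \in span_seq l)).
    split=> [|a b c [u uK hu] [x xK hx]]; first by exists 0; rewrite ?scale0r ?subrr rpred0.
    exists (a *: u + x); first by rewrite rpredD // rpredZ.
    by rewrite scalerDl scaleR -scalerA opprD addrACA -scalerBr rpredD // rpredZ.
  by move=> a ala; exists (f a); [apply/mem_span_seq/map_f | case: (faP a ala)].
have sub1 : {subset span_seq (map f la) <= span_seq (map f la ++ l0)}.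
  by apply: span_seqS => x xl; rewrite mem_cat xl.
have sub2 : {subset span_seq l0 <= span_seq (map f la ++ l0)}.
  by apply: span_seqS => x xl; rewrite mem_cat xl orbT.
rewrite -(subrK w v) rpredD ?(sub1 w) // sub2 // -l0K; apply/andP; split.
  apply: memB => //; move: w ws {wa}; apply: span_sub => _ /mapP[b bl ->].
  by case: (faP b bl).
apply: congr_trans ha _; exact: memBC.
Qed.

End NoetherianRing.

(** * Local rings *)

Section Local.
Variables (R : comNzRingType) (R_noeth : noetherian_ring R).
Variables (m : ideal R) (R_local : local_ring m).

Lemma proper_sub_max (I : ideal R) : 1 \notin I -> {subset I <= m}.
Proof.
move=> I1; have [|Q [IQ Q1] Qmax] := noetherian_maximal (noetherian_ring_module R_noeth)
  (P := fun Q : ideal R => {subset I <= Q} /\ (1 : R) \notin Q); first by exists I; split.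
have Qm : Q =i m.
  apply: R_local.2; split=> // Q' QQ' Q'1 a; apply/idP/idP; last exact: QQ'.
  by apply: Qmax => //; split=> // b /IQ /QQ'.
by move=> a /IQ; rewrite Qm.
Qed.

Lemma unit_1B (a : R) : a \in m -> exists u, u * (1 - a) = 1.
Proof.
move=> am; have hI : prop_submod_closed (V := R^o) (fun b : R^o => exists u : R, u * (1 - a) = b).
  split=> [|c _ _ [u <-] [v <-]]; first by exists 0; rewrite mul0r.
  by exists (c * u + v); rewrite mulrDl -mulrA.
have [/prop_submodP//|/negP I1] := EM ((1 : R^o) \in prop_submod hI).
have m1 : 1 \notin m by case: R_local.1.
case/negP: m1; rewrite -(subrK a 1); apply: rpredD => //; apply: (proper_sub_max I1).
by apply/prop_submodP; exists 1; rewrite mul1r.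
Qed.

(** If T were not inside T', choose W maximal among the submodules containing T'
    but not T. For a in J and t in T, either a t is in W, or T lies in W + R a t,
    whence (1 - r a) t is in W for some r, so t is in W; in both cases a t is in
    W. Hence J T, and with it T, lies in W. *)
Lemma nakayama (J : ideal R) (V : lmodType R) (T T' : submodClosed V) :
  1 \notin J -> noetherian_module V ->
  (forall t, t \in T -> exists2 t', t' \in T' & t - t' \in mul_mod J T) ->
  {subset T <= T'}.
Proof.
move=> J1 noethV hT t tT; apply: contrapT => tT'.
have [|W [T'W nTW] Wmax] := noetherian_maximal noethV
  (P := fun W => {subset T' <= W} /\ ~ {subset T <= W}).
  by exists T'; split=> // /(_ t tT).
apply: nTW => s /hT[t' /T'W t'W]; move=> h; apply: mem_congr t'W; move: h.
move: (s - t'); apply: mul_sub => a {}s aJ sT.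
have hW : prop_submod_closed (fun v => exists r : R, v - r *: (a *: s) \in W).
  split=> [|c u v [p hp] [q hq]]; first by exists 0; rewrite scale0r subrr rpred0.
  by exists (c * p + q); rewrite scalerDl -scalerA opprD addrACA -scalerBr rpredD // rpredZ.
have WW : {subset W <= prop_submod hW}.
  by move=> w wW; apply/prop_submodP; exists 0; rewrite scale0r subr0.
have asW : a *: s \in prop_submod hW by apply/prop_submodP; exists 1; rewrite scale1r subrr rpred0.
have [TW|nTW] := EM {subset T <= prop_submod hW}; last first.
  by apply: (Wmax (prop_submod hW)) => //; split=> // x /T'W /WW.
have /prop_submodP[r hr] := TW s sT.
have [|u hu] := unit_1B (a := r * a); first exact/(proper_sub_max J1)/(rpredZ (s := J) r).
rewrite rpredZ // -(scale1r s) -hu -scalerA rpredZ //.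
by rewrite scalerBl scale1r -scalerA.
Qed.

End Local.

(** * The Hilbert basis theorem for commuting operators *)

Section HilbertBasis.
Variables (R : comNzRingType) (V : lmodType R) (X : nat -> {linear V -> V}).
Hypothesis X_comm : forall i j v, X i (X j v) = X j (X i v).
Implicit Types (U K E S : submodClosed V).

Definition stable (p : nat) U : Prop :=
  forall i u, (i < p)%N -> u \in U -> X i u \in U.

(** The R[X_0, ..., X_(p-1)]-submodule generated by S. *)
Definition stable_span (p : nat) (S : V -> Prop) : {pred V} :=
  fun v => `[< forall K, stable p K -> (forall s, S s -> s \in K) -> v \in K >].

Fact stable_span_closed p (S : V -> Prop) : submod_closed (stable_span p S).
Proof.
split=> [|a u v /asboolP hu /asboolP hv]; apply/asboolP => K stK SK.
  exact: rpred0.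
by rewrite rpredD ?rpredZ ?hu ?hv.
Qed.
HB.instance Definition _ p (S : V -> Prop) :=
  GRing.isSubmodClosed.Build R V (stable_span p S) (stable_span_closed p S).

Lemma mem_stable_span p (S : V -> Prop) v : S v -> v \in stable_span p S.
Proof. by move=> Sv; apply/asboolP => K _; apply. Qed.

Lemma stable_stable_span p (S : V -> Prop) : stable p (stable_span p S).
Proof.
move=> i u ip /asboolP hu; apply/asboolP => K stK SK.
exact: (stK i u ip (hu K stK SK)).
Qed.

Lemma stable_span_sub p (S : V -> Prop) K : stable p K ->
  (forall s, S s -> s \in K) -> {subset stable_span p S <= K}.
Proof. by move=> stK SK v /asboolP; apply. Qed.

Lemma stable_span_ind p (S P : V -> Prop) : prop_submod_closed P ->
  (forall i v, (i < p)%N -> P v -> P (X i v)) ->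
  (forall s, S s -> P s) -> forall v, v \in stable_span p S -> P v.
Proof.
move=> hP stP SP v vS; apply/(prop_submodP hP); move: v vS.
apply: stable_span_sub => [i u ip /prop_submodP Pu|s /SP Ps]; apply/prop_submodP => //.
exact: stP.
Qed.

(** Every R[X_0, ..., X_(p-1)]-submodule of E is finitely generated. *)
Definition noetherian_upto (p : nat) E : Prop :=
  forall U, stable p U -> {subset U <= E} ->
  exists2 l : seq V, {subset l <= U} & {subset U <= stable_span p (fun v => v \in l)}.

Section AddOperator.
Variables (p : nat) (S : submodClosed V).
Hypotheses (S_stable : stable p S) (S_noeth : noetherian_upto p S).
Notation f := (X p).

(** The elements that are polynomials of degree less than d in the operator
    [X p], with coefficients in S. *)
Fixpoint below (d : nat) (v : V) : Prop :=
  if d is d'.+1 then exists s u, [/\ s \in S, below d' u & v = iter d' f s + u]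
  else v = 0.

Lemma iter_linear d : linear (iter d f).
Proof. by elim: d => // d IHd a u v; rewrite !iterS IHd linearP. Qed.

Lemma iter0 d : iter d f 0 = 0.
Proof. by elim: d => //= d ->; rewrite linear0. Qed.

Lemma iter_comm d i v : X i (iter d f v) = iter d f (X i v).
Proof. by elim: d => //= d <-; rewrite X_comm. Qed.

Lemma below_closed d : prop_submod_closed (below d).
Proof.
elim: d => [|d [IH0 IHP]]; first by split=> // a _ _ -> ->; rewrite scaler0 addr0.
split=> [|a _ _ [s [u [sS hu ->]]] [t [v [tS hv ->]]]].
  exists 0, 0; split; rewrite ?rpred0 ?addr0 ?iter0 //.
exists (a *: s + t), (a *: u + v); split; first by rewrite rpredD ?rpredZ.
  exact: IHP.
by rewrite iter_linear scalerDr addrACA.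
Qed.

Lemma belowB d u v : below d u -> below d v -> below d (u - v).
Proof. by move=> hu hv; rewrite addrC -scaleN1r; exact: (below_closed d).2. Qed.

Lemma below_stable d i v : (i < p)%N -> below d v -> below d (X i v).
Proof.
move=> ip; elim: d v => [|d IHd] v /=; first by move=> ->; rewrite linear0.
case=> [s [u [sS hu ->]]]; exists (X i s), (X i u).
by split; [exact: S_stable | exact: IHd | rewrite linearD iter_comm].
Qed.

Lemma below_f d v : below d v -> below d.+1 (f v).
Proof.
elim: d v => [|d IHd] v; first by move=> ->; rewrite linear0; exact: (below_closed 1).1.
by case=> [s [u [sS hu ->]]]; exists s, (f u); rewrite linearD; split=> //; exact: IHd.
Qed.

Lemma below_iter e d v : below d v -> below (e + d) (iter e f v).
Proof. by elim: e => //= e IHe /IHe; exact: below_f. Qed.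

Lemma belowW d e v : (d <= e)%N -> below d v -> below e v.
Proof.
move=> /subnK <-; elim: (e - d)%N => // n IHn /IHn h.
exists 0, v; split=> //; first exact: rpred0.
by rewrite iter0 add0r.
Qed.

Variable U : submodClosed V.
Hypothesis U_stable : stable p.+1 U.

(** The leading coefficients of the elements of U of degree d in [X p]. *)
Definition lead (d : nat) (v : V) : Prop :=
  v \in S /\ exists2 u, below d u & iter d f v + u \in U.

Lemma lead_closed d : prop_submod_closed (lead d).
Proof.
split=> [|a v w [vS [u hu vuU]] [wS [z hz wzU]]].
  split; [exact: rpred0 | exists 0; first exact: (below_closed d).1].
  by rewrite addr0 iter0 rpred0.
split; first by rewrite rpredD ?rpredZ.
exists (a *: u + z); first exact: (below_closed d).2.
by rewrite iter_linear addrACA -scalerDr rpredD ?rpredZ.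
Qed.

Lemma lead_stable d i v : (i < p)%N -> lead d v -> lead d (X i v).
Proof.
move=> ip [vS [u hu vuU]]; split; first exact: S_stable.
exists (X i u); first exact: below_stable.
by rewrite -iter_comm -linearD; apply: U_stable => //; exact: ltnW.
Qed.

Lemma leadW d e v : (d <= e)%N -> lead d v -> lead e v.
Proof.
move=> /subnK <-; elim: (e - d)%N => // n IHn /IHn[vS [u hu vuU]].
split=> //; exists (f u); first exact: below_f.
by rewrite addSn iterS -linearD; apply: U_stable.
Qed.

(** The modules of leading coefficients increase with the degree, so they are
    constant from some degree D on; lifts of generators of those of degree at
    most D generate U, by descent on the degree. *)
Lemma hilbert_basis_step : (forall u, u \in U -> exists d, below d u) ->
  exists2 l : seq V, {subset l <= U} & {subset U <= stable_span p.+1 (fun v => v \in l)}.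
Proof.
move=> Ubelow.
pose L d := prop_submod (lead_closed d).
have hLoo : prop_submod_closed (fun v => exists d, lead d v).
  split=> [|a u v [d hd] [e he]]; first by exists 0%N; exact: (lead_closed 0).1.
  exists (maxn d e); apply: (lead_closed _).2.
    exact: leadW (leq_maxl _ _) hd.
  exact: leadW (leq_maxr _ _) he.
have [||l lL Ll] := S_noeth (U := prop_submod hLoo).
- by move=> i u ip /prop_submodP[d hd]; apply/prop_submodP; exists d; exact: lead_stable.
- by move=> u /prop_submodP[d []].
have [D hD] : exists D, forall v, v \in l -> lead D v.
  elim: (l) lL {Ll} => [|v l' IHl] hl; first by exists 0%N.
  have [w wl|d hd] := IHl; first by apply: hl; rewrite inE wl orbT.
  have /prop_submodP[e he] := hl v (mem_head _ _).
  exists (maxn d e) => w; rewrite inE => /predU1P[->|/hd].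
    exact: leadW (leq_maxr _ _) he.
  exact: leadW (leq_maxl _ _).
have leadD d v : lead d v -> lead D v.
  move=> dv; have: v \in prop_submod hLoo by apply/prop_submodP; exists d.
  move=> /Ll; apply: stable_span_ind => //; first exact: lead_closed.
  by move=> i w; exact: lead_stable.
have gens d : exists G : seq V, {subset G <= L d} /\
    {subset L d <= stable_span p (fun v => v \in G)}.
  have [||G ? ?] := S_noeth (U := L d); last by exists G.
    by move=> i u ip /prop_submodP hd; apply/prop_submodP; exact: lead_stable.
  by move=> u /prop_submodP[].
have [G hG] := choice gens.
have lifts (dv : nat * V) : exists w, lead dv.1 dv.2 ->
    w \in U /\ exists2 u, below dv.1 u & w = iter dv.1 f dv.2 + u.
  have [[_ [u hu wU]]|nl] := EM (lead dv.1 dv.2); last by exists 0.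
  by exists (iter dv.1 f dv.2 + u) => _; split=> //; exists u.
have [lift hlift] := choice lifts.
pose gl := flatten [seq [seq lift (d, v) | v <- G d] | d <- iota 0 D.+1].
have glU : {subset gl <= U}.
  move=> w /flatten_mapP[d _ /mapP[v vG ->]].
  have /prop_submodP dv : v \in L d by exact: (hG d).1.
  by case: (hlift (d, v) dv).
exists gl => //; pose W : submodClosed V := stable_span p.+1 (fun v => v \in gl).
have claim_le d v : (d <= D)%N -> lead d v ->
    exists2 w, w \in W & exists2 u, below d u & w = iter d f v + u.
  move=> dD dv; have: v \in L d by apply/prop_submodP.
  move=> /(hG d).2.
  apply: (stable_span_ind (P := fun v => exists2 w, w \in W & exists2 u, below d u &
    w = iter d f v + u)).
  - split=> [|a x y [w wW [u hu wE]] [z zW [t ht zE]]].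
      exists 0; rewrite ?rpred0 //; exists 0; first exact: (below_closed d).1.
      by rewrite addr0 iter0.
    exists (a *: w + z); first by rewrite rpredD ?rpredZ.
    exists (a *: u + t); first exact: (below_closed d).2.
    by rewrite wE zE iter_linear scalerDr addrACA.
  - move=> i x ip [w wW [u hu wE]]; exists (X i w).
      by apply: stable_stable_span => //; exact: ltnW.
    exists (X i u); first exact: below_stable.
    by rewrite wE linearD iter_comm.
  - move=> s sG; have /prop_submodP ds : s \in L d by exact: (hG d).1.
    exists (lift (d, s)); last by case: (hlift (d, s) ds).
    apply: mem_stable_span; apply/flatten_mapP; exists d; last exact: map_f.
    by rewrite mem_iota.
have claim d v : lead d v -> exists2 w, w \in W & exists2 u, below d u & w = iter d f v + u.
  move=> dv; have [dD|/ltnW Dd] := leqP d D; first exact: claim_le.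
  have [w wW [u hu wE]] := claim_le D v (leqnn D) (leadD _ _ dv).
  exists (iter (d - D) f w).
    elim: (d - D)%N => //= n IHn; exact: stable_stable_span.
  exists (iter (d - D) f u); first by rewrite -{1}(subnK Dd); exact: below_iter.
  have -> : iter d f v = iter (d - D) f (iter D f v) by rewrite -iterD subnK.
  by rewrite wE -(scale1r (iter D f v)) iter_linear !scale1r.
have WU : {subset W <= U} by apply: stable_span_sub.
move=> u uU; have [d hd] := Ubelow u uU.
elim: d u uU hd => [|d IHd] u uU; first by move=> ->; exact: rpred0.
case=> [s [u0 [sS hu0 uE]]].
have [|w wW [u1 hu1 wE]] := claim d s; first by split=> //; exists u0; rewrite -?uE.
rewrite -(subrK w u); apply: rpredD => //; apply: IHd.
  by apply: memB => //; exact: WU.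
by rewrite uE wE opprD addrACA subrr add0r; exact: belowB.
Qed.

End AddOperator.

Variable M : lmodType R.
Variable (iota0 : {linear M -> V}).

Definition generated (p : nat) : submodClosed V :=
  stable_span p (fun v => exists m, v = iota0 m).

(** Induction on p: every element of [generated p.+1] is a polynomial in X_p with
    coefficients in [generated p]. *)
Theorem hilbert_basis (p : nat) : noetherian_module M -> noetherian_upto p (generated p).
Proof.
move=> noethM; elim: p => [|p IHp] U stU UE.
  have [l lU] := noethM (preim_mod iota0 U).
  exists (map iota0 l) => [_ /mapP[v vl ->]|u uU].
    by have: v \in preim_mod iota0 U by rewrite lU; exact: mem_span_seq.
  have [v uE] : exists v, u = iota0 v.
    have := UE u uU; apply: (stable_span_ind (P := fun u => exists v, u = iota0 v)) => //.
    split=> [|a x y [v ->] [w ->]]; first by exists 0; rewrite linear0.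
    by exists (a *: v + w); rewrite linearP.
  have: v \in preim_mod iota0 U by rewrite /preim_mod unfold_in -uE.
  rewrite lU uE; move: v {uE}.
  apply: (span_ind (P := fun v => iota0 v \in stable_span 0 (fun v0 => v0 \in map iota0 l))).
    split=> [|a x y hx hy]; first by rewrite linear0 rpred0.
    by rewrite linearP rpredD ?rpredZ.
  by move=> s sl; apply: mem_stable_span; exact: map_f.
have stE : stable p (generated p) by exact: stable_stable_span.
apply: (hilbert_basis_step stE IHp stU) => u /UE.
apply: (stable_span_ind (P := fun u => exists d, below p (generated p) d u)).
- split=> [|a v w [d hd] [e he]]; first by exists 0%N.
  exists (maxn d e); apply: (below_closed _ _ _).2.
    exact: belowW (leq_maxl _ _) hd.
  exact: belowW (leq_maxr _ _) he.
- move=> i v; rewrite ltnS leq_eqVlt => /predU1P[->|ip] [d hd].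
    by exists d.+1; exact: below_f.
  by exists d; exact: below_stable.
- move=> _ [m ->]; exists 1%N, (iota0 m), 0; split=> //=; last by rewrite addr0.
  by apply: mem_stable_span; exists m.
Qed.

End HilbertBasis.

(** * The Artin-Rees lemma and Krull's intersection theorem *)

Section ArtinRees.
Variables (R : comNzRingType) (M : lmodType R).

Lemma seq0E n : (0 : nat -> M) n = 0.
Proof. by []. Qed.

Lemma seqPE a (u v : nat -> M) n : (a *: u + v) n = a *: u n + v n.
Proof. by []. Qed.

(** A sequence stands for the power series over M in a variable t with these
    coefficients; this is the multiplication by a t. *)
Definition shift (a : R) (v : nat -> M) : nat -> M :=
  fun n => if n is n'.+1 then a *: v n' else 0.

Fact shift_linear a : linear (shift a).
Proof.
move=> b u v; apply/funext => -[|n]; rewrite ?seq0E ?seqPE /=.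
  by rewrite scaler0 addr0.
by rewrite scalerDr !scalerA mulrC.
Qed.
HB.instance Definition _ a :=
  GRing.isLinear.Build R (nat -> M) (nat -> M) _ (shift a) (shift_linear a).

Lemma shift_comm a b v : shift a (shift b v) = shift b (shift a v).
Proof. by apply/funext => -[|[|n]] //=; rewrite ?scaler0 // !scalerA mulrC. Qed.

Definition constant (v : M) : nat -> M := fun n => if n is 0 then v else 0.

Fact constant_linear : linear constant.
Proof. by move=> b u v; apply/funext => -[|n]; rewrite ?seq0E ?seqPE //= scaler0 addr0. Qed.
HB.instance Definition _ :=
  GRing.isLinear.Build R M (nat -> M) _ constant constant_linear.

Definition monomial (n : nat) (v : M) : nat -> M := fun k => if k == n then v else 0.

Fact monomial_linear n : linear (monomial n).
Proof.
move=> b u v; apply/funext => k; rewrite ?seq0E ?seqPE /monomial.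
by case: eqP => // _; rewrite scaler0 addr0.
Qed.
HB.instance Definition _ n :=
  GRing.isLinear.Build R M (nat -> M) _ (monomial n) (monomial_linear n).

Lemma shift_monomial a n v : shift a (monomial n v) = monomial n.+1 (a *: v).
Proof. by apply/funext => -[|k] //=; rewrite /monomial eqSS; case: eqP => // _; rewrite scaler0. Qed.

Definition AR_number (J : ideal R) (K : submodClosed M) (c : nat) : Prop :=
  forall n v, (c <= n)%N -> v \in powM J M n -> v \in K ->
  v \in mul_mod (ideal_exp J (n - c)) (cap_mod (powM J M c) K).

(** The other inclusion holds for all c. *)
Lemma AR_numberP (J : ideal R) (K : submodClosed M) c :
  (forall n, (c <= n)%N -> cap_mod (mul_mod (ideal_exp J n) (full_mod M)) K =i
    mul_mod (ideal_exp J (n - c)) (cap_mod (mul_mod (ideal_exp J c) (full_mod M)) K))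
  <-> AR_number J K c.
Proof.
split=> [h n v cn vJ vK|h n cn v]; first by rewrite -h //; apply/andP.
apply/idP/idP=> [/andP[]|]; first exact: h.
move=> hv; apply/andP; split; last by move: hv => /mul_subr /andP[].
rewrite -(subnK cn) mul_expD; move: v hv; apply: mulS => // u.
by case/andP.
Qed.

(** In the Rees module, the sum of the J^n M t^n, the graded submodule of the
    elements with all coefficients in K is finitely generated over the Rees
    algebra of J; any bound c on the degrees of generators is an Artin-Rees
    number. *)
Theorem artin_rees_exists (J : ideal R) (K : submodClosed M) :
  noetherian_ring R -> noetherian_module M -> exists c, AR_number J K c.
Proof.
move=> noethR noethM; have [p [y Jy]] := noethR J.
(* The generators of J, extended by 0 to a sequence of operators. *)
pose yn i := if insub i is Some k then y k else 0.
pose X i : {linear (nat -> M) -> (nat -> M)} := shift (yn i).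
have ynJ i : yn i \in J.
  by rewrite /yn; case: insubP => [k _ _|_]; [rewrite Jy; apply: mem_span; exists k | exact: rpred0].
have Xc i j v : X i (X j v) = X j (X i v) by exact: shift_comm.
pose E := generated X constant p.
have E_pow v n : v \in E -> v n \in powM J M n.
  move=> vE; move: v vE n; apply: stable_span_ind.
  - by split=> [n|a u v hu hv n]; rewrite ?seq0E ?seqPE ?rpred0 ?rpredD ?rpredZ.
  - move=> i v _ hv [|n]; first exact: powM0.
    by apply: (powM_scale (m := 1)) => //; exact: mem_exp1.
  - by move=> _ [m ->] [|n]; [exact: powM0 | exact: rpred0].
have E_fin v : v \in E -> exists d, forall n, (d < n)%N -> v n = 0.
  apply: (stable_span_ind (P := fun v : nat -> M => exists d, forall n, (d < n)%N -> v n = 0)).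
  - split=> [|a u {}v [d hd] [e he]]; first by exists 0%N.
    exists (maxn d e) => n; rewrite gtn_max => /andP[dn en].
    by rewrite ?seq0E ?seqPE hd ?he // scaler0 addr0.
  - by move=> i {}v _ [d hd]; exists d.+1 => -[|n] //= dn; rewrite hd ?scaler0.
  - by move=> _ [m ->]; exists 0%N => -[].
have pow_E n v : v \in powM J M n -> monomial n v \in E.
  elim: n v => [|n IHn] v.
    move=> _; apply: mem_stable_span; exists v; by apply/funext => -[].
  rewrite /powM mul_expS; apply: (mul_ind (P := fun v => monomial n.+1 v \in E)).
    by split=> [|a u w hu hw]; rewrite ?linear0 ?rpred0 // linearP rpredD ?rpredZ.
  move=> a {}v aJ vJ; rewrite -shift_monomial.
  have: a \in ideal_gen y by rewrite -Jy.
  apply: (span_ind (V := R^o) (P := fun a : R^o => shift a (monomial n v) \in E)).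
    split=> [|b c d]; rewrite !shift_monomial; first by rewrite scale0r linear0 rpred0.
    by move=> hc hd; rewrite scalerDl scaleR -scalerA linearP rpredD ?rpredZ.
  move=> _ [i ->].
  have -> : y i = yn i by rewrite /yn; case: insubP => [k _ /val_inj ->//|]; rewrite ltn_ord.
  by apply: (stable_stable_span (X := X)) => //; exact: IHn.
have hU : prop_submod_closed (fun v : nat -> M => v \in E /\ forall n, v n \in K).
  split=> [|a u v [uE uK] [vE vK]]; first by split=> [|n]; rewrite ?rpred0.
  by split=> [|n]; rewrite ?seq0E ?seqPE rpredD ?rpredZ.
have [||g gU Ug] := hilbert_basis Xc (iota0 := constant) (p := p) noethM (U := prop_submod hU).
- move=> i v ip /prop_submodP[vE vK]; apply/prop_submodP; split.
    by apply: stable_stable_span.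
  by move=> [|n]; [exact: rpred0 | exact: rpredZ].
- by move=> v /prop_submodP[].
have [c hc] : exists c, forall v, v \in g -> forall n, (c < n)%N -> v n = 0.
  elim: (g) gU {Ug} => [|v g' IHg] hg; first by exists 0%N.
  have [w wg|d hd] := IHg; first by apply: hg; rewrite inE wg orbT.
  have /prop_submodP[vE _] := hg v (mem_head _ _).
  have [e he] := E_fin v vE.
  exists (maxn d e) => w; rewrite inE => /predU1P[->|/hd h] n; rewrite gtn_max => /andP[? ?].
    exact: he.
  exact: h.
exists c => n v cn vJ vK; pose G := cap_mod (powM J M c) K : submodClosed M.
have: monomial n v \in prop_submod hU.
  apply/prop_submodP; split; first exact: pow_E.
  by move=> k; rewrite /monomial; case: eqP; rewrite ?rpred0.
move=> /Ug vg.
suff: forall k, (c <= k)%N -> monomial n v k \in mul_mod (ideal_exp J (k - c)) G.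
  by move=> /(_ n cn); rewrite /monomial eqxx.
(* Multiplication by J t preserves the Artin-Rees relation in degrees at least c,
   and the generators vanish in degrees larger than c. *)
pose Q (w : nat -> M) := [/\ forall k, w k \in powM J M k, forall k, w k \in K &
  forall k, (c <= k)%N -> w k \in mul_mod (ideal_exp J (k - c)) G].
suff [] : Q (monomial n v) by [].
move: vg; apply: (stable_span_ind (P := Q)).
- split=> [|a u w [hu1 hu2 hu3] [hw1 hw2 hw3]]; split=> [k|k|k ck]; rewrite ?seq0E ?seqPE ?rpred0 //.
  + by rewrite rpredD ?rpredZ.
  + by rewrite rpredD ?rpredZ.
  + by rewrite rpredD ?rpredZ ?hu3 ?hw3.
- move=> i w ip [hw1 hw2 hw3].
  have h1 k : X i w k \in powM J M k.
    by case: k => [|k]; [exact: powM0 | apply: (powM_scale (m := 1)) => //; exact: mem_exp1].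
  have h2 k : X i w k \in K by case: k => [|k]; [exact: rpred0 | exact: rpredZ].
  split=> // k; rewrite leq_eqVlt => /predU1P[<-|].
    by rewrite subnn mul_exp0; apply/andP.
  case: k => // k ck; rewrite subSn // mul_expS; apply: mem_mul => //; exact: hw3.
- move=> w wg; have /prop_submodP[wE wK] := gU w wg.
  split=> // k; first exact: E_pow.
  rewrite leq_eqVlt => /predU1P[<-|ck]; last by rewrite hc // rpred0.
  by rewrite subnn mul_exp0; apply/andP; split=> //; exact: E_pow.
Qed.

(** If T is the intersection of the submodules C + J^n M, the Artin-Rees lemma
    gives T = C + J T, and Nakayama's lemma applies. *)
Theorem krull_intersection (m : ideal R) (J : ideal R) (C : submodClosed M) v :
  noetherian_ring R -> local_ring m -> 1 \notin J -> noetherian_module M ->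
  (forall n, exists2 u, u \in powM J M n & v - u \in C) -> v \in C.
Proof.
move=> noethR locR J1 noethM hv.
have hT : prop_submod_closed (fun v => forall n, exists2 u, u \in powM J M n & v - u \in C).
  split=> [n|a u w hu hw n]; first by exists 0; rewrite ?subrr rpred0.
  have [u' u'J uu'] := hu n; have [w' w'J ww'] := hw n.
  exists (a *: u' + w'); first by rewrite rpredD ?rpredZ.
  by rewrite opprD addrACA -scalerBr rpredD ?rpredZ.
have CT : {subset C <= prop_submod hT}.
  by move=> w wC; apply/prop_submodP => n; exists 0; rewrite ?rpred0 ?subr0.
have [c hc] := artin_rees_exists J (prop_submod hT) noethR noethM.
have : v \in prop_submod hT by apply/prop_submodP.
apply: (nakayama noethR locR J1 noethM) => t tT.
have /prop_submodP/(_ c.+1)[u uJ tu] := tT.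
exists (t - u) => //; rewrite subKr.
have uT : u \in prop_submod hT by rewrite -(subKr t u); apply: memB => //; exact: CT.
have := hc _ _ (leqnSn c) uJ uT; rewrite subSnn.
apply: mulS; first exact: exp1_sub.
by move=> w /andP[].
Qed.

End ArtinRees.

(** * Quotients and subquotients *)

Section Quotients.
Local Open Scope quotient_scope.
Variables (R : comNzRingType) (V : lmodType R).
Implicit Types (A B K : submodClosed V).

Definition qproj K (v : V) : quot_mod K := \pi_(quot_mod K) v.

Fact qproj_linear K : linear (qproj K).
Proof. by move=> a u v; rewrite /qproj raddfD; congr (_ + _); exact/esym/quot_scale_pi. Qed.
HB.instance Definition _ K :=
  GRing.isLinear.Build R V (quot_mod K) _ (qproj K) (qproj_linear K).

Lemma qproj_eq K u v : qproj K u = qproj K v <-> u - v \in K.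
Proof.
have -> : (u - v \in K) = (qproj K u == qproj K v) by rewrite -Quotient.idealrBE.
by split=> /eqP.
Qed.

Lemma qproj_eq0 K v : qproj K v = 0 <-> v \in K.
Proof. by rewrite -(linear0 (qproj K)) qproj_eq subr0. Qed.

Lemma qproj_surj K (z : quot_mod K) : exists v, z = qproj K v.
Proof. by exists (repr z); rewrite /qproj reprK. Qed.

End Quotients.

Section Subquotients.
Variables (R : comNzRingType) (V : lmodType R).
Implicit Types (A B : submodClosed V).

Definition sqproj A B (u : submod_type A) : subquot A B := qproj _ u.
Arguments sqproj A B u : clear implicits.

Lemma sqproj_eq0 A B (u : submod_type A) : sqproj A B u = 0 <-> val u \in B.
Proof. exact: qproj_eq0. Qed.

Lemma sqproj_surj A B (z : subquot A B) : exists u, z = sqproj A B u.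
Proof. exact: qproj_surj. Qed.

Lemma sqprojZ A B a (u : submod_type A) : a *: sqproj A B u = sqproj A B (a *: u).
Proof. exact: (esym (linearZ_LR (qproj _) a u)). Qed.

Lemma sqproj_eq A B (u v : submod_type A) :
  sqproj A B u = sqproj A B v <-> val u - val v \in B.
Proof. exact: qproj_eq. Qed.

Lemma subquot_killed A B (I : ideal R) :
  (forall v, v \in mul_mod I (full_mod (subquot A B)) -> v = 0) <->
  (forall (a : R) u, a \in I -> u \in A -> a *: u \in B).
Proof.
split=> [h a u aI uA|h v].
  have /h : a *: sqproj A B (exist _ u uA) \in mul_mod I (full_mod _) by exact: mem_mul.
  by rewrite sqprojZ => /sqproj_eq0.
apply: (mul_ind (P := fun v : subquot A B => v = 0)).
  by split=> // a _ _ -> ->; rewrite scaler0 addr0.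
move=> a z aI _; have [u ->] := sqproj_surj z.
by rewrite sqprojZ; apply/sqproj_eq0/h => //; exact: valP.
Qed.

End Subquotients.
Arguments sqproj {R V} A B u.

Lemma least_spec (P : nat -> Prop) : (exists n, P n) -> P (least P).
Proof.
move=> [n Pn]; rewrite /least; case: xgetP => [k _ [] //|noP].
have ex : exists n, `[< P n >] by exists n; apply/asboolP.
case: (ex_minnP ex) => k /asboolP Pk kmin; case: (noP k); split=> // i Pi.
by apply: kmin; apply/asboolP.
Qed.

(** * Finiteness of Loewy lengths *)

Section LoewyLength.
Variables (R : comNzRingType) (R_noeth : noetherian_ring R) (J : ideal R).
Variables (M : lmodType R) (M_noeth : noetherian_module M).

(** If J^n (I : x) were in I for no n, let T be the union of the increasing
    sequence I : J^n, so that T = I : J^n for some n. A maximal annihilator Q in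
    M / T of a multiple w of an element of I : x is prime; J is not inside Q since
    T : J = T, so some b in J^n is outside Q, and Q, which contains x, is the
    annihilator of b w in M / I. *)
Lemma loewy_finite (I : submodClosed M) (x : R) :
  (forall p : ideal R, associated_prime (quot_mod I) p -> ~ {subset J <= p} -> x \notin p) ->
  exists n, forall (a : R) v, a \in ideal_exp J n -> x *: v \in I -> a *: v \in I.
Proof.
move=> x_reg.
have hT n : prop_submod_closed (fun v => forall a : R, a \in ideal_exp J n -> a *: v \in I).
  split=> [a _|a u v hu hv b bJ]; first by rewrite scaler0 rpred0.
  by rewrite scalerDr scalerA mulrC -scalerA; apply: rpredD; [apply/rpredZ/hu | apply: hv].
pose T n : submodClosed M := prop_submod (hT n).
have [|_ [n ->] nmax] := noetherian_maximal M_noeth (P := fun K => exists n, K = T n).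
  by exists (T 0%N), 0%N.
have TS : {subset T n.+1 <= T n}.
  apply: nmax; first by exists n.+1.
  move=> v /prop_submodP hv; apply/prop_submodP => a /(exp_decr (leqnSn n)); exact: hv.
exists n => a v aJ xv; apply: contrapT => av.
have IT w : w \in I -> w \in T n by move=> wI; apply/prop_submodP => b _; exact: rpredZ.
have vT : v \notin T n by apply/negP => /prop_submodP/(_ a aJ).
have hQ w : prop_submod_closed (V := R^o) (fun c : R^o => (c : R) *: w \in T n).
  split=> [|c b d hb hd]; first by rewrite scale0r rpred0.
  by rewrite scalerDl scaleR -scalerA rpredD // rpredZ.
pose ann w : ideal R := prop_submod (hQ w).
have [|_ [r rvT ->] Qmax] := noetherian_maximal (noetherian_ring_module R_noeth)
    (P := fun Q : ideal R => exists2 r : R, r *: v \notin T n & Q = ann (r *: v)).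
  by exists (ann (1 *: v)), 1; rewrite ?scale1r.
set w := r *: v in rvT Qmax *; set Q := ann w in Qmax.
have QP c : reflect (c *: w \in T n) (c \in Q) by exact: (prop_submodP (hQ w)).
have Q_prime : prime_ideal Q.
  split=> [|c d cdQ]; first by apply/QP; rewrite scale1r; exact/negP.
  have [cQ|cQ] := EM (c \in Q); [by left | right].
  apply: (Qmax (ann ((c * r) *: v))).
  - exists (c * r) => //; apply/negP => h; apply: cQ; apply/QP.
    by rewrite /w scalerA.
  - move=> e /QP he; apply/(prop_submodP (hQ _)).
    by rewrite -scalerA scalerA mulrC -scalerA rpredZ.
  apply/(prop_submodP (hQ _)); rewrite -scalerA scalerA mulrC; exact/QP.
have nJQ : ~ {subset J <= Q}.
  move=> JQ; case/negP: rvT; apply: TS; apply/prop_submodP => b.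
  apply: (mul_ind (V := R^o) (P := fun b : R^o => (b : R) *: w \in I)).
    split=> [|c d e hd he]; first by rewrite scale0r rpred0.
    by rewrite scalerDl scaleR -scalerA rpredD // rpredZ.
  move=> j c /JQ/QP/prop_submodP h /h; by rewrite scaleR mulrC -scalerA.
have [j jJ jQ] : exists2 j, j \in J & j \notin Q.
  apply: contrapT => h; apply: nJQ => j jJ; apply: contrapT => /negP jQ; apply: h; by exists j.
have jn k : j ^+ k \in ideal_exp J k.
  elim: k => // k IHk; rewrite exprS; exact: mem_mulR.
have jnQ k : j ^+ k \notin Q.
  elim: k => [|k IHk]; first by rewrite expr0; exact: Q_prime.1.
  by apply/negP; rewrite exprS => /Q_prime.2[]; exact/negP.
have Q_ass : associated_prime (quot_mod I) Q.
  split=> //; exists (qproj I (j ^+ n *: w)) => c; rewrite -linearZ qproj_eq0.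
  split=> [/QP/prop_submodP/(_ _ (jn n)) h|h]; first by rewrite scalerA mulrC -scalerA.
  have /Q_prime.2[//|h'] : c * j ^+ n \in Q by apply/QP/IT; rewrite -scalerA.
  by have := jnQ n; rewrite h'.
have := x_reg _ Q_ass nJQ; case/negP; apply/QP/IT.
by rewrite /w scalerA mulrC -scalerA rpredZ.
Qed.

End LoewyLength.

(** * Perturbing one element *)

Section Adjoin.
Variables (R : comNzRingType) (J : ideal R) (M : lmodType R).
Implicit Types (K : submodClosed M) (x y : R).

Lemma scaleC (a b : R) (v : M) : a *: (b *: v) = b *: (a *: v).
Proof. by rewrite !scalerA mulrC. Qed.

Fact adjoin_closed K x : prop_submod_closed (fun v => exists u, v - x *: u \in K).
Proof.
split=> [|a v w [u hu] [t ht]]; first by exists 0; rewrite scaler0 subrr rpred0.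
by exists (a *: u + t); rewrite scalerDr scaleC opprD addrACA -scalerBr rpredD // rpredZ.
Qed.

(** The submodule K + x M. *)
Definition adjoin K x : submodClosed M := prop_submod (adjoin_closed K x).

Lemma adjoinP K x v : reflect (exists u, v - x *: u \in K) (v \in adjoin K x).
Proof. exact: (prop_submodP (adjoin_closed K x)). Qed.

Lemma adjoin_mul (I : ideal R) K x v : v \in mul_mod I (adjoin K x) ->
  exists2 u, u \in mul_mod I (full_mod M) & v - x *: u \in K.
Proof.
move: v; apply: (mul_ind (P := fun v => exists2 u, u \in mul_mod I (full_mod M) & v - x *: u \in K)).
  split=> [|a v w [u uI hu] [t tI ht]]; first by exists 0; rewrite ?scaler0 ?subrr rpred0.
  exists (a *: u + t); first by rewrite rpredD // rpredZ.
  by rewrite scalerDr scaleC opprD addrACA -scalerBr rpredD // rpredZ.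
move=> a v aI /adjoinP[u hu]; exists (a *: u); first exact: mem_mul.
by rewrite scaleC -scalerBr rpredZ.
Qed.

(** J^n (K : x) is contained in K. *)
Definition kills_colon (n : nat) K x : Prop :=
  forall (a : R) v, a \in ideal_exp J n -> x *: v \in K -> a *: v \in K.

Lemma kills_colonW m n K x : (m <= n)%N -> kills_colon m K x -> kills_colon n K x.
Proof. by move=> /exp_decr mn h a v /mn; exact: h. Qed.

(** If x u = y v modulo K, then b v = x w modulo K for b in J^q, so that b u - y w
    is in K : x, and J^p carries it into K. *)
Lemma kills_colon_swap p q K x y :
  kills_colon p K x -> kills_colon q (adjoin K x) y -> kills_colon (p + q) (adjoin K y) x.
Proof.
move=> hx hy a u aJ /adjoinP[v xuv]; move: a aJ => a /expD_split.
move: a; apply: (mul_ind (V := R^o) (P := fun a : R^o => (a : R) *: u \in adjoin K y)).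
  split=> [|a b c hb hc]; first by rewrite scale0r rpred0.
  by rewrite scalerDl scaleR -scalerA rpredD // rpredZ.
move=> a b aJ bJ; rewrite scaleR -scalerA; apply/adjoinP.
have /(hy b v bJ)/adjoinP[w hw] : y *: v \in adjoin K x.
  by apply/adjoinP; exists u; exact: memBC.
exists (a *: w); rewrite (scaleC y a) -scalerBr; apply: hx => //.
have -> : x *: (b *: u - y *: w) = b *: (x *: u - y *: v) + y *: (b *: v - x *: w).
  by rewrite !scalerBr (scaleC x b) (scaleC x y) (scaleC y b) addrA subrK.
by rewrite rpredD ?rpredZ.
Qed.

End Adjoin.

Section Perturbation.
Variables (R : comNzRingType) (R_noeth : noetherian_ring R).
Variables (m : ideal R) (R_local : local_ring m) (J : ideal R) (J_proper : 1 \notin J).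
Variables (M : lmodType R) (M_noeth : noetherian_module M).
Variables (K : submodClosed M) (x eps : R) (N : nat).
Hypothesis eps_pow : eps \in ideal_exp J N.
Hypothesis eps_colon : forall v, x *: v \in K -> eps *: v \in K.
Notation x' := (x + eps).

Section ArtinReesBound.
Variable c : nat.
Hypotheses (cN : (c < N)%N) (AR_c : AR_number J (adjoin K x) c).

(** Successive approximation: if v is in J^k M modulo K : x, then
    x v = x' v - eps v is in J^(N + k) M + J^n M modulo K, and the Artin-Rees
    property moves v into J^(N + k - c) M + J^(n - c) M modulo K : x. As c < N, the
    order of v grows until it reaches n - c. *)
Lemma small_solution n u v : (c <= n)%N -> u \in powM J M n -> x' *: v - u \in K ->
  exists2 w, w \in powM J M (n - c) & x *: (v - w) \in K.
Proof.
move=> cn uJ xvu.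
suff H k : exists2 w, w \in powM J M (minn k (n - c)) & x *: (v - w) \in K.
  by have := H (n - c)%N; rewrite minnn.
elim: k => [|k [w wJ xvw]].
  by exists v; [rewrite min0n powM0 | rewrite subrr scaler0 rpred0].
set k' := minn _ _ in wJ; pose n' := minn n (N + k').
have uwJ : u - eps *: w \in powM J M n'.
  apply: memB; first exact: powM_decr (geq_minl _ _) _ uJ.
  exact: powM_decr (geq_minr _ _) _ (powM_scale eps_pow wJ).
have xvE : x *: v - (u - eps *: w) \in K.
  have -> : x *: v - (u - eps *: w) = (x' *: v - u) - eps *: (v - w).
    rewrite scalerDl scalerBr !opprB -(addrA (x *: v)) -addrA; congr (_ + _).
    by rewrite [RHS]addrC addrA subrK.
  by rewrite memB // eps_colon.
have uwA : u - eps *: w \in adjoin K x by apply/adjoinP; exists v; exact: memBC.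
have cn' : (c <= n')%N by rewrite leq_min cn (leq_trans (ltnW cN) (leq_addr _ _)).
have := AR_c cn' uwJ uwA.
have sub z : z \in cap_mod (powM J M c) (adjoin K x) -> z \in adjoin K x by case/andP.
move=> /(mulS (fun _ h => h) sub) /adjoin_mul[z zJ hz].
exists z; first by apply: powM_decr zJ; rewrite /n' /k'; move: cN cn; clear; lia.
by rewrite scalerBr; exact: congr_trans xvE hz.
Qed.

(** If x' v is in K, the previous lemma for all n and Krull's intersection theorem
    show that v is in K : x. *)
Lemma colon_perturbed v : (x' *: v \in K) = (x *: v \in K).
Proof.
apply/idP/idP=> [xv|xv]; last by rewrite scalerDl rpredD // eps_colon.
apply: (krull_intersection (C := colon K x) R_noeth R_local J_proper M_noeth) => n.
have [||w wJ hw] := @small_solution (n + c) 0 v (leq_addl _ _); rewrite ?rpred0 ?subr0 //.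
by exists w => //; rewrite addnK in wJ.
Qed.

(** Up to J^(n+1) M, an element of J^n M in K + x' M is one of K + x M, to which
    the Artin-Rees relation applies, and the relation can be carried back to
    K + x' M with the same error. Hence it holds for K + x' M up to terms of
    arbitrarily high order, which are handled by some Artin-Rees number of
    K + x' M. *)
Lemma AR_perturbed : AR_number J (adjoin K x') c.
Proof.
pose G x := cap_mod (powM J M c) (adjoin K x) : submodClosed M.
have G_adj y e : {subset mul_mod (ideal_exp J e) (G y) <= adjoin K y}.
  by move=> w /mul_subr /andP[].
have step n v : (c <= n)%N -> v \in powM J M n -> v \in adjoin K x' ->
    exists2 w, w \in mul_mod (ideal_exp J (n - c)) (G x') & v - w \in powM J M n.+1.
  move=> cn vJ /adjoinP[u hu].
  have [w wJ hw] := small_solution cn vJ (memBC hu).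
  have eJ : eps *: w \in powM J M n.+1.
    by apply: powM_decr (powM_scale eps_pow wJ); lia.
  have yJ : v - eps *: w \in powM J M n by apply: memB => //; exact: powM_decr (leqnSn n) _ eJ.
  have yA : v - eps *: w \in adjoin K x.
    apply/adjoinP; exists w.
    have -> : v - eps *: w - x *: w = (v - x' *: u) + x' *: (u - w).
      by rewrite scalerBr addrA subrK scalerDl opprD addrA addrAC.
    by rewrite rpredD // colon_perturbed.
  have [z zG hz] : exists2 z, z \in mul_mod (ideal_exp J (n - c)) (G x') &
      v - eps *: w - z \in powM J M n.+1.
    move: (v - eps *: w) (AR_c cn yJ yA).
    apply: (mul_ind (P := fun y => exists2 z, z \in mul_mod (ideal_exp J (n - c)) (G x') &
      y - z \in powM J M n.+1)).
      split=> [|a y z [s sG hs] [t tG ht]]; first by exists 0; rewrite ?subrr rpred0.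
      exists (a *: s + t); first by rewrite rpredD // rpredZ.
      by rewrite opprD addrACA -scalerBr rpredD // rpredZ.
    move=> a g aJ /andP[gJ /adjoinP[s hs]].
    have esJ k : (k <= N)%N -> eps *: s \in powM J M k.
      by move=> kN; apply: powM_decr (powM_scale eps_pow (powM0 J s)); rewrite addn0.
    exists (a *: (g + eps *: s)).
      apply: mem_mul => //; apply/andP; split; first by rewrite rpredD // esJ // ltnW.
      by apply/adjoinP; exists s; rewrite scalerDl opprD addrACA subrr addr0.
    rewrite -scalerBr opprD addrA subrr add0r scalerN; apply: memN.
    by apply: powM_decr (powM_scale aJ (esJ c.+1 cN)); rewrite addnS subnK.
  exists z => //; rewrite -(subrK (eps *: w) v) addrAC rpredD //.
(* On J^(n + c0) M the relation for c0 leaves a factor J^n. *)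
have [c0 hc0] := artin_rees_exists J (adjoin K x') R_noeth M_noeth.
move=> n v cn vJ vA.
have [w wG hw] : exists2 w, w \in mul_mod (ideal_exp J (n - c)) (G x') &
    v - w \in powM J M (n + c0).
  elim: c0 {hc0} => [|e [w wG hw]]; first by exists 0; rewrite ?rpred0 // subr0 addn0.
  have [||z zG hz] := step (n + e)%N (v - w) _ hw; first exact: leq_trans (leq_addr _ _).
    by apply: memB => //; exact: G_adj wG.
  exists (w + z); last by rewrite opprD addrA addnS.
  by rewrite rpredD //; apply: mul_exp_decr zG; rewrite leq_sub2r ?leq_addr.
rewrite -(subrK w v) rpredD //.
have := hc0 _ _ (leq_addl _ _) hw (memB vA (G_adj _ _ _ wG)); rewrite addnK => h.
have {h} : v - w \in mul_mod (ideal_exp J n) (adjoin K x').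
  by move: h; apply: mulS => // z /andP[].
rewrite -{1}(subnK cn) mul_expD; apply: mulS => // z zJ; apply/andP; split.
  by move: zJ; apply: mulS.
exact: mul_subr zJ.
Qed.

End ArtinReesBound.

(** Let y u = x v modulo K and, for b in J^q, write b u = x s(b) modulo K. For
    eps = sum of g a b with g in J, a in J^p, b in J^q, the element
    l = sum of g a s(b) behaves like (eps / x) u: modulo K one has y l = eps v and
    b l = eps s(b) for b in J^q, so b (u + l) = x' s(b). If v = 0, then l is in
    J (K : y), so by Nakayama's lemma J^q carries all of K : y into K + x' M.
    An arbitrary element of (K + x' M) : y is the sum of such an u + l and of an
    element of K : y. *)
Lemma kills_colon_perturbed p q y : (p + q < N)%N ->
  kills_colon J p K x -> kills_colon J q (adjoin K x) y ->
  (forall v, x' *: v \in adjoin K y -> x *: v \in adjoin K y) ->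
  kills_colon J q (adjoin K x') y.
Proof.
move=> pqN hx hy hxy.
pose T : submodClosed M := colon K y.
have TE t : (t \in T) = (y *: t \in K) by [].
pose rel (I : submodClosed M) u v (e : R) (l : M) := [/\ y *: l - e *: v \in K,
  v = 0 -> l \in I &
  forall (b : R) s, b \in ideal_exp J q -> b *: u - x *: s \in K -> b *: l - e *: s \in K].
have rel_lin (I : submodClosed M) u v : prop_submod_closed (V := R^o)
    (fun e : R^o => exists l, rel I u v e l).
  split=> [|a e f [l [l1 l2 l3]] [k [k1 k2 k3]]].
    exists 0; split=> [|_|b s _ _]; rewrite ?scaler0 ?scale0r ?subrr ?rpred0 //.
  exists (a *: l + k); split=> [|v0|b s bJ bs].
  - rewrite scalerDl scaleR -scalerA scalerDr scaleC opprD addrACA -scalerBr.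
    by rewrite rpredD // rpredZ.
  - by rewrite rpredD ?k2 // rpredZ ?l2.
  - rewrite scalerDl scaleR -scalerA scalerDr scaleC opprD addrACA -scalerBr.
    by rewrite rpredD ?(k3 _ _ bJ bs) // rpredZ ?(l3 _ _ bJ bs).
have rel_ab u v : y *: u - x *: v \in K -> forall e : R,
    e \in ideal_exp J (p + q) -> exists l, rel T u v e l.
  move=> yuv e /expD_split; move: e.
  apply: (mul_ind (V := R^o) (P := fun e : R^o => exists l, rel T u v e l)) => // a b aJ bJ.
  have /(hy b u bJ)/adjoinP[s hs] : y *: u \in adjoin K x by apply/adjoinP; exists v.
  have yl : y *: (a *: s) - (a * b) *: v \in K.
    rewrite scaleC -scalerA -scalerBr; apply: hx => //.
    have -> : x *: (y *: s - b *: v) = b *: (y *: u - x *: v) - y *: (b *: u - x *: s).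
      by rewrite !scalerBr (scaleC y b) (scaleC x b) (scaleC x y) opprB [RHS]addrC addrA subrK.
    by rewrite memB // rpredZ.
  exists (a *: s); split=> // [v0|b' s' b'J hs'].
    by move: yl; rewrite v0 scaler0 subr0.
  rewrite scaleR scaleC -scalerA -scalerBr; apply: hx => //.
  have -> : x *: (b' *: s - b *: s') = b *: (b' *: u - x *: s') - b' *: (b *: u - x *: s).
    by rewrite !scalerBr (scaleC x b) (scaleC x b') (scaleC b b') opprB [RHS]addrC addrA subrK.
  by rewrite memB // rpredZ.
have rel_eps u v : y *: u - x *: v \in K -> exists l, rel (mul_mod J T) u v eps l.
  move=> yuv; have : eps \in ideal_exp J (p + q).+1 by exact: exp_decr eps_pow.
  move: eps; apply: (mul_ind (V := R^o) (P := fun e : R^o => exists l, rel (mul_mod J T) u v e l)) => // g e gJ eJ.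
  have [l [l1 l2 l3]] := rel_ab u v yuv e eJ.
  exists (g *: l); split=> [|v0|b s bJ bs].
  - by rewrite scaleR scaleC -scalerA -scalerBr rpredZ.
  - by apply: mem_mul => //; exact: l2.
  - by rewrite scaleR scaleC -scalerA -scalerBr rpredZ ?(l3 _ _ bJ bs).
have shifted u v l : y *: u - x *: v \in K -> rel (mul_mod J T) u v eps l ->
    forall b : R, b \in ideal_exp J q -> b *: (u + l) \in adjoin K x'.
  move=> yuv [_ _ h3] b bJ.
  have /(hy b u bJ)/adjoinP[s hs] : y *: u \in adjoin K x by apply/adjoinP; exists v.
  apply/adjoinP; exists s; rewrite scalerDr scalerDl opprD addrACA rpredD //.
  exact: h3.
have hT' : prop_submod_closed (fun t => forall b : R, b \in ideal_exp J q -> b *: t \in adjoin K x').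
  split=> [b _|a t s ht hs b bJ]; first by rewrite scaler0 rpred0.
  by rewrite scalerDr scaleC rpredD ?hs // rpredZ ?ht.
have TT' : {subset T <= prop_submod hT'}.
  apply: (nakayama R_noeth R_local J_proper M_noeth) => t tT.
  have yt : y *: t - x *: 0 \in K by rewrite scaler0 subr0.
  have [l hl] := rel_eps t 0 yt; exists (t + l).
    by apply/prop_submodP; exact: shifted hl.
  by rewrite opprD addrA subrr add0r memN //; case: hl => _ /(_ erefl).
move=> b u bJ /adjoinP[v yuv].
have /hxy/adjoinP[w xvw] : x' *: v \in adjoin K y by apply/adjoinP; exists u; exact: memBC.
have ywv := memBC xvw; have [l hl] := rel_eps w v ywv.
have wlT : u - (w + l) \in T.
  rewrite TE; case: hl => yl _ _.
  rewrite scalerBr scalerDr; apply: congr_trans yuv _.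
  by rewrite scalerDl opprD addrACA rpredD //; exact: memBC.
have /prop_submodP/(_ b bJ) := TT' _ wlT; move=> h.
rewrite -(subrK (w + l) u) scalerDr rpredD //; exact: shifted hl _ bJ.
Qed.

End Perturbation.

(** * Tensoring with matrices *)

Section Tensor.
Variables (R : comNzRingType) (L : lmodType R).
Local Notation "v ** A" := (mx_tensor A v) (at level 40, left associativity).

Lemma tensorM p n q (A : 'M[R]_(p, n)) (B : 'M_(n, q)) (v : {ffun 'I_p -> L}) :
  v ** (A *m B) = v ** A ** B.
Proof.
apply/ffunP => k; rewrite !ffunE.
under eq_bigr do rewrite mxE scaler_suml.
rewrite exchange_big /=; apply: eq_bigr => j _; rewrite ffunE scaler_sumr.
by apply: eq_bigr => i _; rewrite scalerA mulrC.
Qed.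

Lemma tensorDl p n (A B : 'M[R]_(p, n)) (v : {ffun 'I_p -> L}) :
  v ** (A + B) = v ** A + v ** B.
Proof.
apply/ffunP => k; rewrite !ffunE -big_split /=.
by apply: eq_bigr => i _; rewrite mxE scalerDl.
Qed.

Lemma tensorNl p n (A : 'M[R]_(p, n)) (v : {ffun 'I_p -> L}) : v ** (- A) = - (v ** A).
Proof.
apply/ffunP => k; rewrite !ffunE -sumrN.
by apply: eq_bigr => i _; rewrite mxE scaleNr.
Qed.

Lemma tensor0 p n (v : {ffun 'I_p -> L}) : v ** (0 : 'M[R]_(p, n)) = 0.
Proof. by apply/ffunP => k; rewrite !ffunE big1 // => i _; rewrite mxE scale0r. Qed.

Lemma tensor0l p n (A : 'M[R]_(p, n)) : (0 : {ffun 'I_p -> L}) ** A = 0.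
Proof. exact: linear0. Qed.

Lemma tensor_scalar n (a : R) (v : {ffun 'I_n -> L}) : v ** a%:M = a *: v.
Proof.
apply/ffunP => k; rewrite !ffunE (bigD1 k) //= mxE eqxx big1 ?addr0 // => i ik.
by rewrite mxE (negPf ik) scale0r.
Qed.

End Tensor.

Section FunctionSubmodules.
Variables (R : comNzRingType) (M : lmodType R).
Implicit Types K : submodClosed M.
Local Notation "v ** A" := (mx_tensor A v) (at level 40, left associativity).

Fact ffun_submod_closed K n :
  prop_submod_closed (fun v : {ffun 'I_n -> M} => forall i, v i \in K).
Proof.
split=> [i|a u v hu hv i]; first by rewrite ffunE rpred0.
by rewrite !ffunE rpredD // rpredZ.
Qed.

Definition ffun_submod K n : submodClosed {ffun 'I_n -> M} :=
  prop_submod (ffun_submod_closed K n).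

Lemma ffun_submodP K n (v : {ffun 'I_n -> M}) :
  reflect (forall i, v i \in K) (v \in ffun_submod K n).
Proof. exact: (prop_submodP (ffun_submod_closed K n)). Qed.

Lemma mem_submod_sum K (I : finType) (f : I -> M) : (forall i, f i \in K) -> \sum_i f i \in K.
Proof. by move=> h; apply: (big_ind (fun v => v \in K)) => [|u v|i _]; [exact: rpred0 | exact: rpredD | exact: h]. Qed.

Lemma tensor_mem K p n (A : 'M[R]_(p, n)) v :
  v \in ffun_submod K p -> v ** A \in ffun_submod K n.
Proof.
move=> /ffun_submodP vK; apply/ffun_submodP => k; rewrite ffunE.
by apply: mem_submod_sum => i; rewrite rpredZ.
Qed.

Lemma tensor_ideal_mem K (b : ideal R) p n (A : 'M[R]_(p, n)) (v : {ffun 'I_p -> M}) :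
  (forall i k, A i k \in b) -> (forall (a : R) i, a \in b -> a *: v i \in K) ->
  v ** A \in ffun_submod K n.
Proof.
move=> Ab bK; apply/ffun_submodP => k; rewrite ffunE.
by apply: mem_submod_sum => i; exact: bK.
Qed.

Definition qmap K n (v : {ffun 'I_n -> M}) : {ffun 'I_n -> quot_mod K} :=
  [ffun i => qproj K (v i)].

Fact qmap_linear K n : linear (@qmap K n).
Proof. by move=> a u v; apply/ffunP => i; rewrite !ffunE linearP. Qed.
HB.instance Definition _ K n :=
  GRing.isLinear.Build R {ffun 'I_n -> M} {ffun 'I_n -> quot_mod K} _ (@qmap K n) (@qmap_linear K n).

Lemma qmap_eq0 K n (v : {ffun 'I_n -> M}) : qmap K v = 0 <-> v \in ffun_submod K n.
Proof.
split=> [h|/ffun_submodP h].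
  by apply/ffun_submodP => i; apply/qproj_eq0; move/ffunP: h => /(_ i); rewrite !ffunE.
by apply/ffunP => i; rewrite !ffunE; apply/qproj_eq0.
Qed.

Lemma qmap_eq K n (u v : {ffun 'I_n -> M}) : qmap K u = qmap K v <-> u - v \in ffun_submod K n.
Proof.
rewrite -qmap_eq0; have -> : qmap K (u - v) = qmap K u - qmap K v.
  by apply/ffunP => i; rewrite !ffunE linearB.
by split=> [->|/eqP]; rewrite ?subrr // subr_eq0 => /eqP.
Qed.

Lemma qmap_surj K n (z : {ffun 'I_n -> quot_mod K}) : exists v, z = qmap K v.
Proof.
have [f hf] := choice (@qproj_surj _ _ K).
by exists [ffun i => f (z i)]; apply/ffunP => i; rewrite !ffunE -hf.
Qed.

Lemma qmap_tensor K p n (A : 'M[R]_(p, n)) (v : {ffun 'I_p -> M}) :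
  qmap K (v ** A) = qmap K v ** A.
Proof.
apply/ffunP => k; rewrite !ffunE linear_sum.
by apply: eq_bigr => i _; rewrite linearZ !ffunE.
Qed.

Lemma ffun_adjoin K x n (v : {ffun 'I_n -> M}) : v \in ffun_submod (adjoin K x) n ->
  exists w, v - x *: w \in ffun_submod K n.
Proof.
move=> /ffun_submodP h; have [f hf] := choice (fun i => adjoinP K x (v i) (h i)).
exists [ffun i => f i]; apply/ffun_submodP => i; rewrite !ffunE; exact: hf.
Qed.

End FunctionSubmodules.

(** * Dimensions of subquotients over the residue field *)

Lemma linear_comb (R : comNzRingType) (U V : lmodType R) (f : {linear U -> V})
    d (c : 'I_d -> R) (u : 'I_d -> U) :
  f (\sum_i c i *: u i) = \sum_i c i *: f (u i).
Proof. by rewrite linear_sum; apply: eq_bigr => i _; rewrite linearZ. Qed.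

Section ResidueDimension.
Variables (R : comNzRingType) (m : ideal R).

Lemma residue_dimP (V : lmodType R) (A B : submodClosed V) d :
  has_residue_dim m (subquot A B) d <->
  (forall (a : R) v, a \in m -> v \in A -> a *: v \in B) /\
  exists e : 'I_d -> V, [/\ forall i, e i \in A,
    forall v, v \in A -> exists c : 'I_d -> R, v - \sum_i c i *: e i \in B &
    forall c : 'I_d -> R, \sum_i c i *: e i \in B -> forall i, c i \in m].
Proof.
have comb (e : 'I_d -> submod_type A) (c : 'I_d -> R) :
    \sum_i c i *: sqproj A B (e i) = sqproj A B (\sum_i c i *: e i).
  exact/esym/(linear_comb (qproj _)).
have vcomb (e : 'I_d -> submod_type A) (c : 'I_d -> R) :
    val (\sum_i c i *: e i) = \sum_i c i *: val (e i).
  exact: (linear_comb (val : {linear submod_type A -> V})).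
split=> [[mk [e [gen free]]]|[mk [e [eA gen free]]]].
  have [f hf] := choice (fun i => sqproj_surj (e i)).
  have eE c : \sum_i c i *: e i = sqproj A B (\sum_i c i *: f i).
    by rewrite -comb; apply: eq_bigr => i _; rewrite hf.
  split=> [a v am vA|].
    have := mk a (sqproj A B (exist _ v vA)) am.
    by rewrite sqprojZ => /sqproj_eq0.
  exists (fun i => val (f i)); split=> [i|v vA|c].
  - exact: valP.
  - have [c hc] := gen (sqproj A B (exist _ v vA)); exists c.
    by move: hc; rewrite eE => /sqproj_eq; rewrite vcomb.
  - by rewrite -vcomb => /sqproj_eq0; rewrite -eE; exact: free.
pose f i : submod_type A := exist _ (e i) (eA i).
split=> [a z am|].
  have [u ->] := sqproj_surj z; rewrite sqprojZ; apply/sqproj_eq0/mk => //; exact: valP.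
exists (fun i => sqproj A B (f i)); split=> [z|c].
  have [u ->] := sqproj_surj z; have [c hc] := gen (val u) (valP u); exists c.
  by rewrite comb; apply/sqproj_eq; rewrite vcomb.
by rewrite comb => /sqproj_eq0; rewrite vcomb; exact: free.
Qed.

(** A linear relation that is total on both sides and identifies B with B' induces
    an isomorphism of A / B with A' / B'. *)
Lemma residue_dim_correspondence (V V' : lmodType R)
    (A B : submodClosed V) (A' B' : submodClosed V') (rel : V -> V' -> Prop) d :
  (forall a z1 z1' z2 z2', rel z1 z1' -> rel z2 z2' -> rel (a *: z1 + z2) (a *: z1' + z2')) ->
  rel 0 0 ->
  (forall z z', rel z z' -> z \in A /\ z' \in A') ->
  (forall z, z \in A -> exists z', rel z z') ->
  (forall z', z' \in A' -> exists z, rel z z') ->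
  (forall z z', rel z z' -> z \in B <-> z' \in B') ->
  has_residue_dim m (subquot A B) d -> has_residue_dim m (subquot A' B') d.
Proof.
move=> relP rel0 relA totA totA' relB /residue_dimP[mk [e [eA gen free]]].
have relZ a z z' : rel z z' -> rel (a *: z) (a *: z').
  by move=> h; have := relP a _ _ _ _ h rel0; rewrite !addr0.
have relD z1 z1' z2 z2' : rel z1 z1' -> rel z2 z2' -> rel (z1 + z2) (z1' + z2').
  by move=> h1 h2; have := relP 1 _ _ _ _ h1 h2; rewrite !scale1r.
have relN z z' : rel z z' -> rel (- z) (- z') by rewrite -!scaleN1r; exact: relZ.
have [e' he'] := choice (fun i => totA (e i) (eA i)).
have rel_comb c : rel (\sum_i c i *: e i) (\sum_i c i *: e' i).
  by apply: (big_ind2 rel) => // i _; exact: relZ.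
apply/residue_dimP; split=> [a v' am /totA'[v vv']|].
  by apply/(relB _ _ (relZ a _ _ vv'))/mk => //; case: (relA _ _ vv').
exists e'; split=> [i|v' /totA'[v vv']|c hc].
- by case: (relA _ _ (he' i)).
- have [vA _] := relA _ _ vv'; have [c hc] := gen v vA; exists c.
  by apply/(relB _ _ (relD _ _ _ _ vv' (relN _ _ (rel_comb c)))).
- by apply: free; apply/(relB _ _ (rel_comb c)).
Qed.

End ResidueDimension.

(** * Comparison of the homology of two quotients *)

Section Comparison.
Variables (R : comNzRingType) (M : lmodType R).
Local Notation "v ** A" := (mx_tensor A v) (at level 40, left associativity).

(** z and z' lift to u and u + w S, where (u, w) is a cycle of the mapping cone of
    x : M / (K : x) -> M / K; its boundary condition is u B = x w. *)
Definition cone_rel (K I I' : submodClosed M) (x : R) (n q : nat)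
    (B : 'M[R]_(n, q)) (S : 'M[R]_(q, n))
    (z : {ffun 'I_n -> quot_mod I}) (z' : {ffun 'I_n -> quot_mod I'}) : Prop :=
  exists u w, [/\ u ** B - x *: w \in ffun_submod K q, z = qmap I u & z' = qmap I' (u + w ** S)].

Section OneSide.
Variables (K I I' : submodClosed M) (x e : R) (b : ideal R).
Hypotheses (IE : I =i adjoin K x) (IE' : I' =i adjoin K (x + e)).
Hypothesis b_colon : forall (a : R) v, a \in b -> x *: v \in K -> a *: v \in K.
Variables (p n q s : nat) (A : 'M[R]_(p, n)) (B : 'M[R]_(n, q)) (C : 'M[R]_(q, s)).
Hypotheses (AB0 : A *m B = 0) (BC0 : B *m C = 0).
Variables (S' : 'M[R]_(n, p)) (S : 'M[R]_(q, n)) (T : 'M[R]_(s, q)).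
Hypotheses (Sb : forall i k, S i k \in b) (Tb : forall i k, T i k \in b).
Hypotheses (hom_n : S' *m A + B *m S = e%:M) (hom_q : S *m B + C *m T = e%:M).
Implicit Types (u v : {ffun 'I_n -> M}) (w : {ffun 'I_q -> M}).

Lemma b_colon_tensor p0 n0 (D : 'M[R]_(p0, n0)) (v : {ffun 'I_p0 -> M}) :
  (forall i k, D i k \in b) -> x *: v \in ffun_submod K p0 -> v ** D \in ffun_submod K n0.
Proof.
move=> Db /ffun_submodP xv; apply: tensor_ideal_mem Db _ => a i ab.
by apply: b_colon => //; have := xv i; rewrite ffunE.
Qed.

Lemma cone_rel_total (z : {ffun 'I_n -> quot_mod I}) : z ** B = 0 ->
  exists z' : {ffun 'I_n -> quot_mod I'}, cone_rel K x B S z z'.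
Proof.
have [u ->] := qmap_surj z; rewrite -qmap_tensor => /qmap_eq0 uB.
have [|w hw] := @ffun_adjoin _ _ K x _ (u ** B).
  by apply/ffun_submodP => i; rewrite -IE; move/ffun_submodP: uB; exact.
by exists (qmap I' (u + w ** S)), u, w.
Qed.

Lemma cone_rel_cycle z z' :
  cone_rel K x B S (z : {ffun 'I_n -> quot_mod I}) (z' : {ffun 'I_n -> quot_mod I'}) -> z ** B = 0.
Proof.
case=> u [w [/ffun_submodP uBw -> _]]; rewrite -qmap_tensor; apply/qmap_eq0/ffun_submodP => i.
rewrite IE; apply/adjoinP; exists (w i); have := uBw i.
by rewrite [X in X \in _]ffunE !ffunE.
Qed.

(** Since B C = 0, x kills w C modulo K, hence so do the entries of T, and
    (u + w S) B = u B + e w - w C T = (x + e) w modulo K. *)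
Lemma cone_rel_sym z z' :
  cone_rel K x B S (z : {ffun 'I_n -> quot_mod I}) (z' : {ffun 'I_n -> quot_mod I'}) ->
  cone_rel K (x + e) B (- S) z' z.
Proof.
case=> u [w [uBw zE z'E]]; exists (u + w ** S), w; split=> //; last first.
  by rewrite tensorNl addrK.
have xwC : x *: (w ** C) \in ffun_submod K s.
  have := tensor_mem C uBw; rewrite linearB linearZ /= -tensorM BC0 tensor0 sub0r.
  by move/memN; rewrite opprK.
have wCT := b_colon_tensor Tb xwC.
have eE : w ** S ** B - e *: w = - (w ** C ** T).
  by rewrite -tensor_scalar -hom_q tensorDl !tensorM opprD addrA subrr add0r.
by rewrite linearD /= scalerDl opprD addrACA eE memB.
Qed.

(** If z = y A, lift y to a; then u = a A + x v modulo K for some v, and x kills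
    w - v B modulo K, so that modulo K
    u + w S = a A + x v + v B S = (a - v S') A + (x + e) v. *)
Lemma cone_rel_boundary z z' :
  cone_rel K x B S (z : {ffun 'I_n -> quot_mod I}) (z' : {ffun 'I_n -> quot_mod I'}) ->
  (exists y, z = y ** A) -> exists y, z' = y ** A.
Proof.
case=> u [w [uBw -> ->]] [y]; have [a ->] := qmap_surj y; rewrite -qmap_tensor => /qmap_eq uaA.
have [|v hv] := @ffun_adjoin _ _ K x _ (u - a ** A).
  by apply/ffun_submodP => i; rewrite -IE; move/ffun_submodP: uaA; exact.
have xwvB : x *: (w - v ** B) \in ffun_submod K q.
  have := tensor_mem B hv; rewrite !linearB linearZ /= -tensorM AB0 tensor0 subr0 => h.
  exact: congr_trans (memBC uBw) h.
have wS := b_colon_tensor Sb xwvB; rewrite linearB /= in wS.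
exists (qmap I' (a - v ** S')); rewrite -qmap_tensor; apply/qmap_eq/ffun_submodP => i.
rewrite IE'; apply/adjoinP; exists (v i).
have key : u + w ** S - (a - v ** S') ** A - (x + e) *: v \in ffun_submod K n.
  have -> : u + w ** S - (a - v ** S') ** A - (x + e) *: v =
      (u - a ** A - x *: v) + (w ** S - v ** B ** S).
    have eE : v ** B ** S = e *: v - v ** S' ** A.
      by rewrite -tensor_scalar -hom_n tensorDl !tensorM addrC addKr.
    rewrite eE linearB /= scalerDl !opprB opprD.
    by rewrite (AC (2*2*2) ((1*4*5)*(2*(3*6)))).
  exact: rpredD.
by move/ffun_submodP: key => /(_ i); rewrite !ffunE.
Qed.

Lemma cone_rel_linear a z1 z1' z2 z2' :
  cone_rel K x B S (z1 : {ffun 'I_n -> quot_mod I}) (z1' : {ffun 'I_n -> quot_mod I'}) ->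
  cone_rel K x B S z2 z2' -> cone_rel K x B S (a *: z1 + z2) (a *: z1' + z2').
Proof.
move=> [u [w [uw -> ->]]] [v [t [vt -> ->]]]; exists (a *: u + v), (a *: w + t).
split.
- rewrite mx_tensor_linear scalerDr (scaleC x a) opprD addrACA -scalerBr.
  by rewrite rpredD // rpredZ.
- by rewrite qmap_linear.
- by rewrite -qmap_linear mx_tensor_linear scalerDr addrACA.
Qed.

Lemma cone_rel0 : cone_rel K x B S (0 : {ffun 'I_n -> quot_mod I}) (0 : {ffun 'I_n -> quot_mod I'}).
Proof.
exists 0, 0; split; first by rewrite tensor0l scaler0 subr0 rpred0.
  exact/esym/qmap_eq0/rpred0.
by rewrite tensor0l addr0; apply/esym/qmap_eq0/rpred0.
Qed.

End OneSide.
End Comparison.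

Section TwoSides.
Variables (R : comNzRingType) (m : ideal R) (M : lmodType R).
Local Notation "v ** A" := (mx_tensor A v) (at level 40, left associativity).

(** The relation between cycles and its inverse, which is the same relation for
    x + e and - e, play symmetric roles. *)
Lemma homology_dim (K I I' : submodClosed M) (x e : R) (b : ideal R)
    p n q s (A : 'M[R]_(p, n)) (B : 'M[R]_(n, q)) (C : 'M[R]_(q, s))
    (S' : 'M[R]_(n, p)) (S : 'M[R]_(q, n)) (T : 'M[R]_(s, q))
    (Z Bd : submodClosed {ffun 'I_n -> quot_mod I})
    (Z' Bd' : submodClosed {ffun 'I_n -> quot_mod I'}) d :
  I =i adjoin K x -> I' =i adjoin K (x + e) ->
  (forall v, ((x + e) *: v \in K) = (x *: v \in K)) ->
  (forall (a : R) v, a \in b -> x *: v \in K -> a *: v \in K) ->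
  A *m B = 0 -> B *m C = 0 ->
  (forall i k, S i k \in b) -> (forall i k, T i k \in b) ->
  S' *m A + B *m S = e%:M -> S *m B + C *m T = e%:M ->
  (forall z, z \in Z <-> z ** B = 0) -> (forall z, z \in Bd <-> exists y, z = y ** A) ->
  (forall z, z \in Z' <-> z ** B = 0) -> (forall z, z \in Bd' <-> exists y, z = y ** A) ->
  has_residue_dim m (subquot Z Bd) d -> has_residue_dim m (subquot Z' Bd') d.
Proof.
move=> IE IE' colonE bK AB BC Sb Tb hn hq ZE BdE ZE' BdE'.
have IE2 : I =i adjoin K (x + e - e) by rewrite addrK.
have bK' (a : R) v : a \in b -> (x + e) *: v \in K -> a *: v \in K.
  by rewrite colonE; exact: bK.
have NSb i k : (- S) i k \in b by rewrite mxE; apply: (memN (K := b)).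
have NTb i k : (- T) i k \in b by rewrite mxE; apply: (memN (K := b)).
have Nhn : - S' *m A + B *m - S = (- e)%:M.
  by rewrite mulNmx mulmxN -opprD hn raddfN.
have Nhq : - S *m B + C *m - T = (- e)%:M.
  by rewrite mulNmx mulmxN -opprD hq raddfN.
have sym z z' : cone_rel K x B S (z : {ffun 'I_n -> quot_mod I}) (z' : {ffun 'I_n -> quot_mod I'}) ->
    cone_rel K (x + e) B (- S) z' z.
  exact: (cone_rel_sym bK BC Tb hq).
have sym' z z' : cone_rel K (x + e) B (- S) (z' : {ffun 'I_n -> quot_mod I'})
    (z : {ffun 'I_n -> quot_mod I}) -> cone_rel K x B S z z'.
  by move=> /(cone_rel_sym bK' BC NTb Nhq); rewrite addrK opprK.
apply: (residue_dim_correspondence (rel := cone_rel K x B S)).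
- by move=> *; exact: cone_rel_linear.
- exact: cone_rel0.
- move=> z z' h; split; first exact/ZE/(cone_rel_cycle IE h).
  exact/ZE'/(cone_rel_cycle IE' (sym _ _ h)).
- by move=> z /ZE; exact: cone_rel_total.
- move=> z' /ZE' z'B.
  have [z /sym' h] : exists z : {ffun 'I_n -> quot_mod I}, cone_rel K (x + e) B (- S) z' z.
    exact: cone_rel_total.
  by exists z.
- move=> z z' h; rewrite BdE BdE'; split.
    exact: (cone_rel_boundary IE IE' bK AB Sb hn h).
  exact: (cone_rel_boundary IE' IE2 bK' AB NSb Nhn (sym _ _ h)).
Qed.

End TwoSides.

(** * Homotopies on a resolution of the residue field *)

Section Homotopy.
Variables (R : comNzRingType) (m : ideal R) (F : free_resolution (quot_mod m)).

Lemma rows_solve p n q (X : 'M[R]_(p, n)) (D : 'M[R]_(q, n)) :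
  (forall i, exists w, row i X = w *m D) -> exists W, X = W *m D.
Proof.
move=> /choice[f hf]; exists (\matrix_i f i); apply/row_matrixP => i.
by rewrite hf row_mul rowK.
Qed.

Lemma diff_diff j : diff F j.+1 *m diff F j = 0.
Proof.
apply/row_matrixP => i; rewrite row0 row_mul.
by apply/(diff_exact (f := F)); exists (delta_mx 0 i); rewrite rowE.
Qed.

Definition homotopy (e : R) (S : forall j, 'M[R]_(rank F j, rank F j.+1)) : Prop :=
  S 0%N *m diff F 0 = e%:M /\
  forall j, S j.+1 *m diff F j.+1 + diff F j *m S j = e%:M.

(** Multiplication by e lifts the zero map of the residue field. *)
Lemma homotopy_exists (e : R) : e \in m -> exists S, homotopy e S.
Proof.
move=> em.
have [S0 hS0] : exists S0 : 'M_(rank F 0, rank F 1), e%:M = S0 *m diff F 0.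
  apply: rows_solve => i; apply/(augm_exact (f := F)).
  rewrite -scalemx1 linearZ linearZ /=.
  have [a ->] := qproj_surj (augm F (row i 1%:M)).
  by rewrite -linearZ; apply/qproj_eq0; rewrite scaleR mulrC; exact: (rpredZ (s := m)).
(* The rows of e - diff j * S are cycles, which is what the next step lifts. *)
pose inv j (S : 'M_(rank F j, rank F j.+1)) := (e%:M - diff F j *m S) *m diff F j = 0.
have step j (S : 'M_(rank F j, rank F j.+1)) : exists S' : 'M_(rank F j.+1, rank F j.+2),
    inv j S -> S' *m diff F j.+1 + diff F j *m S = e%:M /\ inv j.+1 S'.
  have [iS|] := EM (inv j S); last by exists 0.
  have [S' hS'] : exists S', e%:M - diff F j *m S = S' *m diff F j.+1.
    apply: rows_solve => i; apply/(diff_exact (f := F)).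
    by rewrite -row_mul iS row0.
  exists S' => _; split; first by rewrite -hS' subrK.
  rewrite /inv mulmxBl -mulmxA -hS' mulmxBr mulmxA diff_diff mul0mx subr0.
  by rewrite scalar_mxC subrr.
pose S := nat_rect (fun j => 'M[R]_(rank F j, rank F j.+1)) S0 (fun j Sj => sval (cid (step j Sj))).
have SS j : S j.+1 = sval (cid (step j (S j))) by [].
have invS j : inv j (S j).
  elim: j => [|j IHj]; last by rewrite SS; case: (cid _) => S' /= /(_ IHj)[].
  by rewrite /inv mulmxBl -mulmxA -hS0 scalar_mxC subrr.
exists S; split=> [|j]; first by rewrite hS0.
by rewrite SS; case: (cid _) => S' /= /(_ (invS j))[].
Qed.

(** If S is a homotopy for e, then c S is one for e c, and its entries are in any
    ideal containing c. *)
Lemma homotopy_ideal (b : ideal R) (e : R) : e \in mul_mod m b ->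
  exists2 S, homotopy e S & forall j i k, S j i k \in b.
Proof.
move: e; apply: (mul_ind (V := R^o)
  (P := fun e : R^o => exists2 S, homotopy e S & forall j i k, S j i k \in b)).
  split=> [|a e f [S [S0 SS] Sb] [T [T0 TT] Tb]].
    exists (fun j => 0) => [|j i k]; last by rewrite mxE; exact: rpred0.
    by split=> [|j]; rewrite ?mulmx0 mul0mx ?addr0 raddf0.
  exists (fun j => a *: S j + T j) => [|j i k]; last first.
    rewrite !mxE; apply: rpredD; [exact: (rpredZ (s := b)) | exact: Tb].
  have E n : (a *: e + f)%:M = a *: e%:M + f%:M :> 'M[R]_n.
    by rewrite raddfD /= scaleR scale_scalar_mx.
  split=> [|j]; first by rewrite mulmxDl -scalemxAl S0 T0 E.
  by rewrite mulmxDl mulmxDr -scalemxAl -scalemxAr addrACA -scalerDr SS TT E.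
move=> e c /homotopy_exists[S [S0 SS]] cb.
exists (fun j => c *: S j) => [|j i k]; last first.
  by rewrite mxE mulrC; exact: (rpredZ (s := b)).
have E n : (e *: (c : R^o))%:M = c *: e%:M :> 'M[R]_n.
  by rewrite scaleR mulrC scale_scalar_mx.
split=> [|j]; first by rewrite -scalemxAl S0 E.
by rewrite -scalemxAl -scalemxAr -scalerDr SS E.
Qed.

End Homotopy.

(** * Betti and Bass numbers of two quotients *)

Section BettiBassComparison.
Variables (R : comNzRingType) (m : ideal R) (M : lmodType R).
Local Notation "v ** A" := (mx_tensor A v) (at level 40, left associativity).

Lemma mem_ker_tensor (L : lmodType R) p n (A : 'M[R]_(p, n)) (z : {ffun 'I_p -> L}) :
  z \in ker_mod (mx_tensor A) <-> z ** A = 0.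
Proof. by split=> /eqP. Qed.

Lemma mem_im_tensor (L : lmodType R) p n (A : 'M[R]_(p, n)) (z : {ffun 'I_n -> L}) :
  z \in im_mod (mx_tensor A) <-> exists y : {ffun 'I_p -> L}, z = y ** A.
Proof. by split=> /asboolP. Qed.

Section OneDirection.
Variables (K I I' : submodClosed M) (x e : R) (b : ideal R).
Hypotheses (IE : I =i adjoin K x) (IE' : I' =i adjoin K (x + e)).
Hypothesis colonE : forall v, ((x + e) *: v \in K) = (x *: v \in K).
Hypothesis bK : forall (a : R) v, a \in b -> x *: v \in K -> a *: v \in K.
Hypothesis eb : e \in mul_mod m b.
Variables (F : free_resolution (quot_mod m)) (j d : nat).

Lemma Tor_dim_sub : has_residue_dim m (Tor F (quot_mod I) j) d ->
  has_residue_dim m (Tor F (quot_mod I') j) d.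
Proof.
have [S [S0 SS] Sb] := homotopy_ideal F eb.
case: j => [|[|j']].
- apply: (homology_dim (A := diff F 0) (B := 0 : 'M_(_, 0)) (C := 0 : 'M_(0, 0))
    (S' := S 0%N) (S := 0) (T := 0) IE IE' colonE bK).
  + by rewrite mulmx0.
  + by rewrite mulmx0.
  + by case.
  + by case.
  + by rewrite mulmx0 addr0.
  + by rewrite [LHS]flatmx0 [RHS]flatmx0.
  + by move=> z; rewrite tensor0.
  + exact: mem_im_tensor.
  + by move=> z; rewrite tensor0.
  + exact: mem_im_tensor.
- apply: (homology_dim (A := diff F 1) (B := diff F 0) (C := 0 : 'M_(_, 0))
    (S' := S 1%N) (S := S 0%N) (T := 0) IE IE' colonE bK) => //.
  + exact: diff_diff.
  + by rewrite mulmx0.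
  + by case.
  + by rewrite mulmx0 addr0.
  + exact: mem_ker_tensor.
  + exact: mem_im_tensor.
  + exact: mem_ker_tensor.
  + exact: mem_im_tensor.
- apply: (homology_dim (A := diff F j'.+2) (B := diff F j'.+1) (C := diff F j')
    (S' := S j'.+2) (S := S j'.+1) (T := S j') IE IE' colonE bK) => //.
  + exact: diff_diff.
  + exact: diff_diff.
  + exact: mem_ker_tensor.
  + exact: mem_im_tensor.
  + exact: mem_ker_tensor.
  + exact: mem_im_tensor.
Qed.

Lemma Ext_dim_sub : has_residue_dim m (Ext F (quot_mod I) j) d ->
  has_residue_dim m (Ext F (quot_mod I') j) d.
Proof.
have [S [S0 SS] Sb] := homotopy_ideal F eb.
have dd k : (diff F k)^T *m (diff F k.+1)^T = 0 by rewrite -trmx_mul diff_diff trmx0.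
have Sb' k i l : (S k)^T i l \in b by rewrite mxE.
have S0' : (diff F 0)^T *m (S 0%N)^T = e%:M by rewrite -trmx_mul S0 tr_scalar_mx.
have SS' k : (S k)^T *m (diff F k)^T + (diff F k.+1)^T *m (S k.+1)^T = e%:M.
  by rewrite -!trmx_mul -raddfD /= addrC SS tr_scalar_mx.
case: j => [|j'].
- apply: (homology_dim (A := 0 : 'M_(0, _)) (B := (diff F 0)^T) (C := (diff F 1)^T)
    (S' := 0) (S := (S 0%N)^T) (T := (S 1%N)^T) IE IE' colonE bK) => //.
  + by rewrite mul0mx.
  + by rewrite mulmx0 add0r.
  + exact: mem_ker_tensor.
  + move=> z; split=> [/asboolP[u ->]|[y ->]]; first by exists 0; rewrite tensor0.
    by apply/asboolP; exists 0; rewrite tensor0.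
  + exact: mem_ker_tensor.
  + move=> z; split=> [/asboolP[u ->]|[y ->]]; first by exists 0; rewrite tensor0.
    by apply/asboolP; exists 0; rewrite tensor0.
- apply: (homology_dim (A := (diff F j')^T) (B := (diff F j'.+1)^T) (C := (diff F j'.+2)^T)
    (S' := (S j')^T) (S := (S j'.+1)^T) (T := (S j'.+2)^T) IE IE' colonE bK) => //.
  + exact: mem_ker_tensor.
  + exact: mem_im_tensor.
  + exact: mem_ker_tensor.
  + exact: mem_im_tensor.
Qed.

End OneDirection.

(** For every resolution of the residue field, the two modules have homology of
    the same dimensions; in particular one value is the default exactly when the
    other is. *)
Lemma betti_bass_eq (K I I' : submodClosed M) (x e : R) (b : ideal R) j :
  I =i adjoin K x -> I' =i adjoin K (x + e) ->
  (forall v, ((x + e) *: v \in K) = (x *: v \in K)) ->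
  (forall (a : R) v, a \in b -> x *: v \in K -> a *: v \in K) ->
  e \in mul_mod m b ->
  betti m (quot_mod I) j = betti m (quot_mod I') j /\
  bass m (quot_mod I) j = bass m (quot_mod I') j.
Proof.
move=> IE IE' colonE bK eb.
have IE2 : I =i adjoin K (x + e - e) by rewrite addrK.
have colonE' v : ((x + e - e) *: v \in K) = ((x + e) *: v \in K) by rewrite addrK colonE.
have bK' (a : R) v : a \in b -> (x + e) *: v \in K -> a *: v \in K.
  by rewrite colonE; exact: bK.
have Neb : - e \in mul_mod m b by exact: (memN (K := mul_mod m b)).
rewrite /betti /bass; split; congr (xget _ _); apply/seteqP; split=> d [F hF]; exists F.
- exact: Tor_dim_sub IE IE' colonE bK eb _ _ _ hF.
- exact: Tor_dim_sub IE' IE2 colonE' bK' Neb _ _ _ hF.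
- exact: Ext_dim_sub IE IE' colonE bK eb _ _ _ hF.
- exact: Ext_dim_sub IE' IE2 colonE' bK' Neb _ _ _ hF.
Qed.

End BettiBassComparison.

(** * Perturbing one element of a sequence *)

Section Sequences.
Variables (R : comNzRingType) (M : lmodType R) (r : nat).
Implicit Types (x y : 'I_r -> R) (P Q : pred 'I_r).

Fact gen_mod_closed x P :
  prop_submod_closed (fun v : M => exists u : 'I_r -> M, v = \sum_(k | P k) x k *: u k).
Proof.
split=> [|a _ _ [u ->] [v ->]].
  by exists (fun=> 0); rewrite big1 // => k _; rewrite scaler0.
exists (fun k => a *: u k + v k); rewrite scaler_sumr -big_split /=.
by apply: eq_bigr => k _; rewrite scalerDr scaleC.
Qed.

(** The sum of the submodules x_k M with P k. *)
Definition gen_mod x P : submodClosed M := prop_submod (gen_mod_closed x P).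

Lemma gen_modP x P v :
  reflect (exists u : 'I_r -> M, v = \sum_(k | P k) x k *: u k) (v \in gen_mod x P).
Proof. exact: (prop_submodP (gen_mod_closed x P)). Qed.

Lemma mem_gen_mod x P k v : P k -> x k *: v \in gen_mod x P.
Proof.
move=> Pk; apply/gen_modP; exists (fun l => if l == k then v else 0).
rewrite (bigD1 k) //= eqxx big1 ?addr0 // => l /andP[_ /negPf ->].
by rewrite scaler0.
Qed.

Lemma partial_mulE x i : partial_mul x M i =i gen_mod x (fun k => (k < i)%N).
Proof.
move=> v; apply/idP/idP=> [|/gen_modP[u ->]]; last first.
  apply: (big_ind (fun v => v \in partial_mul x M i)); first exact: rpred0.
    by move=> u1 u2; exact: rpredD.
  by move=> k ki; apply: mem_mul => //; apply: mem_span; exists k.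
move: v; apply: mul_sub => a v aI _; move: a aI.
apply: (span_ind (V := R^o)
  (P := fun a : R^o => (a : R) *: v \in gen_mod x (fun k => (k < i)%N))).
  split=> [|a c d hc hd]; first by rewrite scale0r rpred0.
  by rewrite scalerDl scaleR -scalerA rpredD // rpredZ.
by move=> _ [k ki ->]; exact: mem_gen_mod.
Qed.

Lemma eq_gen_mod x y P Q : P =1 Q -> (forall k, P k -> x k = y k) ->
  gen_mod x P =i gen_mod y Q.
Proof.
move=> PQ xy v; apply/gen_modP/gen_modP => -[u ->]; exists u.
  by rewrite -(eq_bigl _ _ PQ); apply: eq_bigr => k /xy ->.
by rewrite -(eq_bigl _ _ PQ); apply: eq_bigr => k /xy ->.
Qed.

Lemma gen_mod_adjoin x P Q k : P k -> (forall l, Q l = P l && (l != k)) ->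
  gen_mod x P =i adjoin (gen_mod x Q) (x k).
Proof.
move=> Pk QE v; apply/gen_modP/adjoinP => [[u ->]|[u /gen_modP[w vE]]].
  exists (u k); apply/gen_modP; exists u.
  by rewrite (bigD1 k) //= addrAC subrr add0r; apply: eq_bigl => l; rewrite QE.
exists (fun l => if l == k then u else w l); rewrite (bigD1 k) //= eqxx.
rewrite -[v](subrK (x k *: u)) vE addrC; congr (_ + _).
by apply: eq_big => l; rewrite QE // => /andP[_ /negPf ->].
Qed.

End Sequences.

Section EqSubmodules.
Variables (R : comNzRingType) (J : ideal R) (M : lmodType R).
Implicit Types K : submodClosed M.

Lemma eq_kills_colon n K K' x : K =i K' -> kills_colon J n K x -> kills_colon J n K' x.
Proof. by move=> KE h a v; rewrite -!KE; exact: h. Qed.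

Lemma eq_adjoin K K' x : K =i K' -> adjoin K x =i adjoin K' x.
Proof. by move=> KE v; apply/adjoinP/adjoinP => -[u]; [rewrite KE | rewrite -KE]; exists u. Qed.

Lemma eq_AR_number K K' c : K =i K' -> AR_number J K c -> AR_number J K' c.
Proof.
move=> KE h n v cn vJ; rewrite -KE => vK; have := h n v cn vJ vK.
by apply: mulS => // w /andP[wJ]; rewrite KE => wK; apply/andP.
Qed.

End EqSubmodules.

Section OneStep.
Variables (R : comNzRingType) (R_noeth : noetherian_ring R).
Variables (m : ideal R) (R_local : local_ring m) (J : ideal R) (J_proper : 1 \notin J).
Variables (M : lmodType R) (M_noeth : noetherian_module M) (r : nat).
Variables (a c : 'I_r -> nat).
Implicit Types (x : 'I_r -> R) (i k l : 'I_r).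

Definition colon_bound x : Prop :=
  forall i, kills_colon J (a i) (gen_mod M x (fun l => (l < i)%N)) (x i).

Definition AR_bound x : Prop :=
  forall i, AR_number J (gen_mod M x (fun l => (l < i.+1)%N)) (c i).

Definition first_but (n : nat) k : pred 'I_r := fun l => (l < n)%N && (l != k).

Lemma gen_but_last x k :
  gen_mod M x (fun l => (l < k)%N) =i gen_mod M x (first_but k.+1 k).
Proof. by apply: eq_gen_mod => // l; rewrite /first_but ltnS ltn_neqAle -val_eqE andbC. Qed.

Lemma sum_prefixS i :
  (\sum_(l < r | (l < i.+1)%N) a l = \sum_(l < r | (l < i)%N) a l + a i)%N.
Proof.
rewrite (bigD1 i) //= addnC; congr (_ + _)%N; apply: eq_bigl => l.
by rewrite ltnS ltn_neqAle andbC -val_eqE.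
Qed.

Lemma adjoin_first x n k : (k < n)%N ->
  gen_mod M x (fun l => (l < n)%N) =i adjoin (gen_mod M x (first_but n k)) (x k).
Proof. by move=> kn; exact: gen_mod_adjoin. Qed.

Lemma adjoin_next x i k : (k < i)%N ->
  gen_mod M x (first_but i.+1 k) =i adjoin (gen_mod M x (first_but i k)) (x i).
Proof.
move=> ki; apply: gen_mod_adjoin => [|l]; rewrite /first_but.
  by rewrite ltnSn /=; apply/eqP => ik; rewrite ik ltnn in ki.
by rewrite ltnS [in LHS]ltn_neqAle -!val_eqE /= -andbA andbC.
Qed.

(** Induction on n: adjoining the next element to the others costs the exponent of
    that element, by [kills_colon_swap]. *)
Lemma colon_bound_swap x k n : colon_bound x -> (k < n <= r)%N ->
  kills_colon J (\sum_(l < r | (l < n)%N) a l) (gen_mod M x (first_but n k)) (x k).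
Proof.
move=> hx; elim: n => // n IHn /andP[]; rewrite ltnS leq_eqVlt => /predU1P[<- _|kn nr].
  apply: eq_kills_colon (gen_but_last x k) _.
  by rewrite sum_prefixS; apply: kills_colonW (leq_addl _ _) (hx k).
have ni : n = Ordinal nr :> nat by [].
set i := Ordinal nr in ni *; rewrite ni.
rewrite sum_prefixS; apply: eq_kills_colon (fun v => esym (adjoin_next (i := i) x kn v)) _.
apply: kills_colon_swap; first by apply: IHn; rewrite kn ltnW.
exact: eq_kills_colon (adjoin_first x kn) (hx i).
Qed.

Variables (x x' : 'I_r -> R) (k : 'I_r) (e : R) (N : nat).
Hypotheses (x'k : x' k = x k + e) (x'l : forall l, l != k -> x' l = x l).
Hypotheses (colon_x : colon_bound x) (AR_x : AR_bound x).
Hypotheses (eJ : e \in ideal_exp J N) (aN : (\sum_l a l + 2 <= N)%N).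
Hypothesis cN : forall i, (c i < N)%N.

Lemma sum_prefix n : (\sum_(l < r | (l < n)%N) a l <= \sum_l a l)%N.
Proof. by rewrite [leqRHS](bigID (fun l => (l < n)%N)) leq_addr. Qed.

Lemma gen_but_perturbed n : gen_mod M x' (first_but n k) =i gen_mod M x (first_but n k).
Proof. by apply: eq_gen_mod => // l /andP[_]; exact: x'l. Qed.

Lemma gen_first_perturbed n : (k < n)%N ->
  gen_mod M x' (fun l => (l < n)%N) =i adjoin (gen_mod M x (first_but n k)) (x k + e).
Proof.
move=> kn v; rewrite (adjoin_first x' kn) x'k; exact: eq_adjoin (gen_but_perturbed n) v.
Qed.

(** The exponent N - 1, rather than N, leaves a factor J of e for the homotopies. *)
Lemma kills_but n (b : R) v : (k < n <= r)%N -> b \in ideal_exp J N.-1 ->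
  x k *: v \in gen_mod M x (first_but n k) -> b *: v \in gen_mod M x (first_but n k).
Proof.
move=> kn bJ; apply: (colon_bound_swap colon_x kn); apply: exp_decr bJ.
by have := sum_prefix n; lia.
Qed.

Lemma eps_but n v : (k < n <= r)%N ->
  x k *: v \in gen_mod M x (first_but n k) -> e *: v \in gen_mod M x (first_but n k).
Proof. by move=> kn; apply: kills_but => //; apply: exp_decr eJ; exact: leq_pred. Qed.

Lemma AR_but n : (k < n <= r)%N ->
  exists2 i : 'I_r, n = i.+1 & AR_number J (adjoin (gen_mod M x (first_but n k)) (x k)) (c i).
Proof.
case: n => // n /andP[kn nr]; exists (Ordinal nr) => //.
exact: (eq_AR_number (adjoin_first x kn) (@AR_x (Ordinal nr))).
Qed.

Lemma colon_but n v : (k < n <= r)%N ->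
  ((x k + e) *: v \in gen_mod M x (first_but n k)) = (x k *: v \in gen_mod M x (first_but n k)).
Proof.
move=> kn; have [i _ hAR] := AR_but kn.
exact: (colon_perturbed R_noeth R_local J_proper M_noeth eJ (fun v => @eps_but n v kn) (cN i) hAR).
Qed.

(** Before the place k the submodules do not change; from k on they are of the form
    K + x k M with K independent of the perturbation. *)
Lemma AR_bound_step : AR_bound x'.
Proof.
move=> i; have [ki|ik] := leqP k i.
  have kn : (k < i.+1 <= r)%N by rewrite ltnS ki ltn_ord.
  apply: eq_AR_number (fun v => esym (gen_first_perturbed (n := i.+1) ki v)) _.
  have [i' [/val_inj <-] hAR] := AR_but kn.
  exact: (AR_perturbed R_noeth R_local J_proper M_noeth eJ (fun v => @eps_but _ v kn) (cN i) hAR).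
apply: eq_AR_number (@AR_x i); apply: eq_gen_mod => // l li; rewrite x'l //.
by apply/eqP => lk; move: ik; rewrite -lk ltnNge -ltnS li.
Qed.

(** Before the place k nothing changes; at k the colon submodule is the same for
    both elements; after k, [kills_colon_perturbed] applies. *)
Lemma colon_bound_step : colon_bound x'.
Proof.
move=> i; have [ki|ik|] := ltngtP k i.
- have kn : (k < i <= r)%N by rewrite ki ltnW.
  have kn1 : (k < i.+1 <= r)%N by rewrite ltnS (ltnW ki) ltn_ord.
  apply: eq_kills_colon (fun v => esym (gen_first_perturbed ki v)) _.
  have -> : x' i = x i by apply: x'l; rewrite -val_eqE /= gtn_eqF.
  apply: (kills_colon_perturbed R_noeth R_local J_proper M_noeth eJ
    (p := \sum_(l < r | (l < i)%N) a l)).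
  + by rewrite -sum_prefixS; have := sum_prefix i.+1; lia.
  + exact: colon_bound_swap.
  + exact: eq_kills_colon (adjoin_first x ki) (@colon_x i).
  + by move=> v; rewrite -!(adjoin_next x ki) colon_but.
- rewrite x'l; last by rewrite -val_eqE /= ltn_eqF.
  apply: eq_kills_colon (@colon_x i); apply: eq_gen_mod => // l li; rewrite x'l //.
  by rewrite -val_eqE /= ltn_eqF // (ltn_trans li).
- move=> /val_inj <- b v bJ.
  have kn : (k < k.+1 <= r)%N by rewrite ltnSn ltn_ord.
  have KE : gen_mod M x' (fun l => (l < k)%N) =i gen_mod M x (fun l => (l < k)%N).
    apply: eq_gen_mod => // l lk; rewrite x'l //.
    by rewrite -val_eqE /= ltn_eqF.
  rewrite !KE x'k gen_but_last colon_but // -gen_but_last; exact: colon_x.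
Qed.

(** The factor J of J^N is in m, and the factor J^(N-1) carries K : x k into K. *)
Lemma betti_bass_step j :
  betti m (quot_mod (partial_mul x M r)) j = betti m (quot_mod (partial_mul x' M r)) j /\
  bass m (quot_mod (partial_mul x M r)) j = bass m (quot_mod (partial_mul x' M r)) j.
Proof.
have kn : (k < r <= r)%N by rewrite ltn_ord leqnn.
apply: (betti_bass_eq (K := gen_mod M x (first_but r k)) (x := x k) (e := e)
  (b := ideal_exp J N.-1)).
- by move=> v; rewrite partial_mulE (adjoin_first x (ltn_ord k)).
- by move=> v; rewrite partial_mulE (gen_first_perturbed (ltn_ord k)).
- by move=> v; exact: colon_but.
- by move=> b v; exact: kills_but.
have NE : N = N.-1.+1 by lia.
have : e \in mul_mod J (ideal_exp J N.-1) by move: eJ; rewrite {1}NE.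
by apply: (mulS (V := R^o)) => //; exact: proper_sub_max.
Qed.

End OneStep.

Theorem mainTheorem1 (R : comNzRingType) (m : ideal R)
    (R_noetherian : noetherian_ring R) (R_local : local_ring m)
    (J : ideal R) (J_proper : 1 \notin J)
    (M : lmodType R) (M_fg : fg_module M)
    (r : nat) (x : 'I_r -> R) (x_regular : filter_regular J M x)
    (N : nat)
    (N_def : N = (maxn (\sum_(i < r) 2 ^ i * colon_length J M x i)
                       (\max_(i < r) artin_rees J (partial_mul x M i.+1)) + 2)%N)
    (eps : 'I_r -> R) (eps_in : forall i, eps i \in ideal_exp J N) (j : nat) :
  let x' := fun i => x i + eps i in
  betti m (quot_mod (partial_mul x M r)) j =
    betti m (quot_mod (partial_mul x' M r)) j /\
  bass m (quot_mod (partial_mul x M r)) j =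
    bass m (quot_mod (partial_mul x' M r)) j.
Proof.
move=> x'.
have M_noeth := fg_module_noetherian R_noetherian M_fg.
pose a := colon_length J M x; pose c (i : 'I_r) := artin_rees J (partial_mul x M i.+1).
have aN : (\sum_l a l + 2 <= N)%N.
  rewrite N_def leq_add2r; apply: leq_trans (leq_maxl _ _).
  by apply: leq_sum => i _; apply: leq_pmull; rewrite expn_gt0.
have cN i : (c i < N)%N.
  rewrite N_def addn2 ltnS; apply: leqW; apply: leq_trans (leq_maxr _ _).
  exact: leq_bigmax i.
have colon0 : colon_bound J M a x.
  move=> i; apply: (eq_kills_colon (partial_mulE x i)).
  pose L := subquot (colon (partial_mul x M i) (x i)) (partial_mul x M i).
  have /subquot_killed kill : forall v, v \in mul_mod (ideal_exp J (a i)) (full_mod L) -> v = 0.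
    apply: (least_spec (P := fun n => forall v, v \in mul_mod (ideal_exp J n) (full_mod L) -> v = 0)).
    have [n hn] := loewy_finite R_noetherian M_noeth (x_regular i).
    by exists n; apply/subquot_killed => b v; exact: hn.
  by move=> b v bJ xv; exact: kill.
have AR0 : AR_bound J M c x.
  move=> i; apply: (eq_AR_number (partial_mulE x i.+1)); apply/AR_numberP.
  apply: (least_spec (P := fun c => forall n, (c <= n)%N -> _)).
  have [c0 hc0] := artin_rees_exists J (partial_mul x M i.+1) R_noetherian M_noeth.
  by exists c0; apply/AR_numberP.
(* The sequence with the first t elements perturbed. *)
pose y t (i : 'I_r) := if (i < t)%N then x i + eps i else x i.
suff H t : (t <= r)%N -> [/\ colon_bound J M a (y t), AR_bound J M c (y t),
    betti m (quot_mod (partial_mul x M r)) j = betti m (quot_mod (partial_mul (y t) M r)) j &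
    bass m (quot_mod (partial_mul x M r)) j = bass m (quot_mod (partial_mul (y t) M r)) j].
  have [_ _ bettiE bassE] := H r (leqnn r).
  have <- : y r = x' by apply/funext => i; rewrite /y ltn_ord.
  by split; [exact: bettiE | exact: bassE].
elim: t => [_|t IHt tr].
  by have -> : y 0%N = x by apply/funext => i; rewrite /y ltn0.
have [colon_y AR_y -> ->] := IHt (ltnW tr).
pose k := Ordinal tr.
have yk : y t.+1 k = y t k + eps k by rewrite /y /= ltnSn ltnn.
have yl l : l != k -> y t.+1 l = y t l.
  by rewrite /y ltnS leq_eqVlt -val_eqE /= => /negPf ->.
have [bettiE bassE] := betti_bass_step R_noetherian R_local J_proper M_noeth yk yl colon_y AR_y
  (eps_in k) aN cN j.
split; [| | exact: bettiE | exact: bassE].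
  exact: (colon_bound_step R_noetherian R_local J_proper M_noeth yk yl colon_y AR_y (eps_in k) aN cN).
exact: (AR_bound_step R_noetherian R_local J_proper M_noeth yk yl colon_y AR_y (eps_in k) aN cN).
Qed.
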